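(* Let $(\mathfrak a,B)$ be a pair over a field $F$ of characteristic $0$ and let $X$ be an $(\mathfrak a,B)$-module. Then the following are equivalent: (i) $X$ is an admissible $(\mathfrak a,B)$-module. (ii) For some extension $F'/F$, $X\otimes_FF'$ is an admissible $(\mathfrak a,B)\otimes_FF'$-module. (iii) For every extension $F'/F$, $X\otimes_FF'$ is an admissible $(\mathfrak a,B)\otimes_FF'$-module.
   Context: A pair $(\mathfrak a,B)$ over $F$ consists of a reductive linear algebraic group $B$ over $F$ (not necessarily connected; connected components assumed geometrically connected), a finite-dimensional Lie algebra $\mathfrak a$ over $F$, a monomorphism $\mathfrak b=\mathrm{Lie}(B)\to\mathfrak a$, and an action of $B$ on $\mathfrak a$ whose differential is the action of $\mathfrak b$ on $\mathfrak a$. An $(\mathfrak a,B)$-module is a locally finite rational $B$-module over $F$ (an ind-object of finite-dimensional rational $B$-representations) with a $B$-equivariant action of $\mathfrak a$ whose restriction to $\mathfrak b$ is the derivative of the $B$-action. $(\mathfrak a,B)\otimes_FF'=(\mathfrak a\otimes_FF',B\times_{\mathrm{Spec}F}\mathrm{Spec}F')$, and modules are base changed accordingly. An $(\mathfrak a,B)$-module $X$ is admissible if $\dim_F\mathrm{Hom}_B(V,X)<\infty$ for every finite-dimensional rational $B$-module $V$ over $F$. *)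

(* Defs.v *)
From HB Require Import structures.
From mathcomp Require Import all_boot all_algebra.
From mathcomp Require Import ring.
From mathcomp Require Import boolp classical_sets functions.

Set Implicit Arguments.
Unset Strict Implicit.
Unset Printing Implicit Defensive.

Import GRing.Theory.
Local Open Scope ring_scope.
Local Open Scope quotient_scope.

Section PresentedModule.
Variables (K : fieldType) (G : choiceType).
Variable P : forall W : lmodType K, (G -> W) -> Prop.

Definition formal_eval (W : lmodType K) (f : G -> W) (s : seq (K * G)) : W :=
  \sum_(p <- s) p.1 *: f p.2.

Definition formal_eq (s t : seq (K * G)) : bool :=
  `[< forall (W : lmodType K) (f : G -> W),
        P f -> formal_eval f s = formal_eval f t >].

Lemma formal_eq_refl : reflexive formal_eq.
Proof. by move=> s; apply/asboolP. Qed.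

Lemma formal_eq_sym : symmetric formal_eq.
Proof.
by move=> s t; apply/asboolP/asboolP => h W f Pf; rewrite (h W f Pf).
Qed.

Lemma formal_eq_trans : transitive formal_eq.
Proof.
move=> s t u /asboolP h1 /asboolP h2; apply/asboolP => W f Pf.
by rewrite (h1 W f Pf) (h2 W f Pf).
Qed.

Canonical formal_equiv :=
  EquivRel formal_eq formal_eq_refl formal_eq_sym formal_eq_trans.

(* The K-module generated by G which is universal for the maps G -> W
   satisfying P: formal K-combinations of elements of G, two of them being
   identified when no map satisfying P separates them. *)
Definition presented := {eq_quot formal_equiv}.

HB.instance Definition _ := Choice.on presented.

Definition generator (g : G) : presented := \pi_presented [:: (1, g)].

(* The factorization of f through presented, meaningful when P f holds. *)
Definition presented_lift (W : lmodType K) (f : G -> W) (x : presented) : W :=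
  formal_eval f (repr x).

Lemma presented_liftE (W : lmodType K) (f : G -> W) s :
  P f -> presented_lift f (\pi_presented s) = formal_eval f s.
Proof.
move=> Pf; rewrite /presented_lift.
have : repr (\pi_presented s) = s %[mod presented] by rewrite reprK.
by move=> /eqmodP/asboolP; apply.
Qed.

Lemma presented_eq (x y : presented) :
  (forall (W : lmodType K) (f : G -> W), P f ->
     presented_lift f x = presented_lift f y) -> x = y.
Proof.
move=> h; rewrite -[x]reprK -[y]reprK; apply/eqmodP/asboolP => W f Pf.
exact: h.
Qed.

Definition presented_add (x y : presented) : presented :=
  \pi_presented (repr x ++ repr y).
Definition presented_scale (c : K) (x : presented) : presented :=
  \pi_presented [seq (c * p.1, p.2) | p <- repr x].
Definition presented_zero : presented := \pi_presented [::].
Definition presented_opp (x : presented) : presented := presented_scale (- 1) x.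

Lemma presented_lift_add (W : lmodType K) (f : G -> W) x y : P f ->
  presented_lift f (presented_add x y) =
  presented_lift f x + presented_lift f y.
Proof. by move=> Pf; rewrite presented_liftE// /formal_eval big_cat. Qed.

Lemma presented_lift_scale (W : lmodType K) (f : G -> W) c x : P f ->
  presented_lift f (presented_scale c x) = c *: presented_lift f x.
Proof.
move=> Pf; rewrite presented_liftE// /formal_eval big_map scaler_sumr.
by apply: eq_bigr => p _; rewrite scalerA.
Qed.

Lemma presented_lift_zero (W : lmodType K) (f : G -> W) : P f ->
  presented_lift f presented_zero = 0.
Proof. by move=> Pf; rewrite presented_liftE// /formal_eval big_nil. Qed.

Definition presented_liftS := (presented_lift_add, presented_lift_scale,
  presented_lift_zero).

Lemma presented_addA : associative presented_add.
Proof.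
by move=> x y z; apply: presented_eq => W f Pf; rewrite !presented_liftS// addrA.
Qed.

Lemma presented_addC : commutative presented_add.
Proof.
by move=> x y; apply: presented_eq => W f Pf; rewrite !presented_liftS// addrC.
Qed.

Lemma presented_add0 : left_id presented_zero presented_add.
Proof.
by move=> x; apply: presented_eq => W f Pf; rewrite !presented_liftS// add0r.
Qed.

Lemma presented_addN : left_inverse presented_zero presented_opp presented_add.
Proof.
move=> x; apply: presented_eq => W f Pf.
by rewrite !presented_liftS// scaleN1r addNr.
Qed.

HB.instance Definition _ := GRing.isZmodule.Build presented
  presented_addA presented_addC presented_add0 presented_addN.

Lemma presented_scaleA a b x :
  presented_scale a (presented_scale b x) = presented_scale (a * b) x.
Proof.
by apply: presented_eq => W f Pf; rewrite !presented_liftS// scalerA.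
Qed.

Lemma presented_scale1 : left_id 1 presented_scale.
Proof.
by move=> x; apply: presented_eq => W f Pf; rewrite !presented_liftS// scale1r.
Qed.

Lemma presented_scaleDr : right_distributive presented_scale +%R.
Proof.
move=> a x y; apply: presented_eq => W f Pf.
by rewrite !presented_liftS// scalerDr.
Qed.

Lemma presented_scaleDl x :
  {morph (fun a => presented_scale a x) : a b / a + b}.
Proof.
move=> a b; apply: presented_eq => W f Pf.
by rewrite !presented_liftS// scalerDl.
Qed.

HB.instance Definition _ := GRing.Zmodule_isLmodule.Build K presented
  presented_scaleA presented_scale1 presented_scaleDr presented_scaleDl.

Lemma presented_lift_linear (W : lmodType K) (f : G -> W) :
  P f -> linear (presented_lift f).
Proof. by move=> Pf a u v; rewrite !presented_liftS. Qed.

Lemma presented_lift_gen (W : lmodType K) (f : G -> W) g :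
  P f -> presented_lift f (generator g) = f g.
Proof.
by move=> Pf; rewrite presented_liftE// /formal_eval big_seq1 scale1r.
Qed.

Lemma presented_ind (Q : presented -> Prop) :
  Q 0 -> (forall x y, Q x -> Q y -> Q (x + y)) ->
  (forall c g, Q (c *: generator g)) -> forall x, Q x.
Proof.
move=> Q0 QD QZ x; rewrite -[x]reprK.
elim: (repr x) => [//|[c g] s IH].
have -> : \pi_presented ((c, g) :: s) = c *: generator g + \pi_presented s.
  apply: presented_eq => W f Pf.
  rewrite presented_lift_linear// presented_lift_gen// !presented_liftE//.
  by rewrite /formal_eval big_cons.
exact: QD.
Qed.

End PresentedModule.

Section LinearMaps.
Variable F : fieldType.

Definition bilin (U V W : lmodType F) (f : U -> V -> W) : Prop :=
  (forall v, linear (f^~ v)) /\ (forall u, linear (f u)).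

Section LinearRules.
Variables (U V : lmodType F) (f : U -> V).
Hypothesis lf : linear f.

Lemma linearmD x y : f (x + y) = f x + f y.
Proof. by rewrite -[x in LHS]scale1r lf scale1r. Qed.

Lemma linearm0 : f 0 = 0.
Proof. by apply: (addIr (f 0)); rewrite -linearmD !add0r. Qed.

Lemma linearmZ c x : f (c *: x) = c *: f x.
Proof. by rewrite -[c *: x]addr0 lf linearm0 addr0. Qed.

Lemma linearmB x y : f (x - y) = f x - f y.
Proof. by rewrite linearmD -scaleN1r linearmZ scaleN1r. Qed.

Lemma linearm_sum (I : Type) (r : seq I) (Q : pred I) (h : I -> U) :
  f (\sum_(i <- r | Q i) h i) = \sum_(i <- r | Q i) f (h i).
Proof. by apply: big_morph; [exact: linearmD | exact: linearm0]. Qed.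

End LinearRules.

Lemma linear_comp (U V W : lmodType F) (f : V -> W) (g : U -> V) :
  linear f -> linear g -> linear (fun x => f (g x)).
Proof. by move=> lf lg a u v; rewrite lg lf. Qed.

Lemma linear_idm (U : lmodType F) : linear (fun x : U => x).
Proof. by []. Qed.

End LinearMaps.

Section Tensor.
Variable F : fieldType.

Definition tens (U V : lmodType F) :=
  presented (fun (W : lmodType F) (f : U * V -> W) =>
    bilin (fun u v => f (u, v))).

HB.instance Definition _ (U V : lmodType F) := GRing.Lmodule.on (tens U V).

Definition tpure (U V : lmodType F) (u : U) (v : V) : tens U V :=
  generator _ (u, v).

(* The linear map tens U V -> W with tpure u v |-> f u v; it is only used for
   bilinear f. *)
Definition tlift (U V W : lmodType F) (f : U -> V -> W) : tens U V -> W :=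
  presented_lift (fun p : U * V => f p.1 p.2).

Section Universal.
Variables U V W : lmodType F.

Lemma tlift_pure (f : U -> V -> W) u v :
  bilin f -> tlift f (tpure u v) = f u v.
Proof. by move=> bf; rewrite /tlift presented_lift_gen. Qed.

Lemma tlift_linear (f : U -> V -> W) : bilin f -> linear (tlift f).
Proof. by move=> bf; exact: presented_lift_linear. Qed.

Lemma tpure_bilin : bilin (@tpure U V).
Proof.
split=> [v a x y | u a x y]; apply: presented_eq => X f bf;
  rewrite presented_lift_linear// !presented_lift_gen//.
  exact: bf.1.
exact: bf.2.
Qed.

Lemma tens_ind (Q : tens U V -> Prop) :
  Q 0 -> (forall x y, Q x -> Q y -> Q (x + y)) ->
  (forall u v, Q (tpure u v)) -> forall x, Q x.
Proof.
move=> Q0 QD Qp; apply: presented_ind => // c [u v].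
have /= <- := linearmZ (tpure_bilin.1 v) c u.
exact: Qp.
Qed.

Lemma tens_ext (f g : tens U V -> W) : linear f -> linear g ->
  (forall u v, f (tpure u v) = g (tpure u v)) -> f =1 g.
Proof.
move=> lf lg fg; apply: tens_ind => //; first by rewrite !linearm0.
by move=> x y fx fy; rewrite !linearmD// fx fy.
Qed.

End Universal.
End Tensor.

Section TensorMaps.
Variable F : fieldType.

Lemma bilin_post (U V W W' : lmodType F) (g : W -> W') (f : U -> V -> W) :
  linear g -> bilin f -> bilin (fun u v => g (f u v)).
Proof.
move=> lg [fl fr]; split=> [v | u] a x y.
  by have /= -> := fl v a x y; rewrite lg.
by rewrite fr lg.
Qed.

Lemma bilin_pre (U V U' V' W : lmodType F) (f : U -> V -> W)
    (g : U' -> U) (h : V' -> V) :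
  linear g -> linear h -> bilin f -> bilin (fun u v => f (g u) (h v)).
Proof.
move=> lg lh [fl fr]; split=> [v | u] a x y /=.
  by rewrite lg; have /= -> := fl (h v) a (g x) (g y).
by rewrite lh fr.
Qed.

Lemma bilin_flip (U V W : lmodType F) (f : U -> V -> W) :
  bilin f -> bilin (fun v u => f u v).
Proof. by case. Qed.

Lemma tlift_bilin (U V W X : lmodType F) (f : U -> V -> W -> X) :
  (forall u, bilin (f u)) -> (forall v w, linear (fun u => f u v w)) ->
  bilin (fun u t => tlift (f u) t).
Proof.
move=> bf lf; split=> [t a x y | u]; last exact: (tlift_linear (bf u)).
elim/tens_ind: t => /= [|s t IHs IHt|v w].
- by rewrite !(linearm0 (tlift_linear (bf _))) scaler0 addr0.
- rewrite !(linearmD (tlift_linear (bf _))) IHs IHt scalerDr.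
  by rewrite addrACA.
- by rewrite !tlift_pure// lf.
Qed.

Lemma tlift_param (U V W X : lmodType F) (f : U -> V -> W -> X) t :
  (forall u, bilin (f u)) -> (forall v w, linear (fun u => f u v w)) ->
  linear (fun u => tlift (f u) t).
Proof. by move=> bf lf; exact: (tlift_bilin bf lf).1. Qed.

Definition tmap (U V U' V' : lmodType F) (f : U -> U') (g : V -> V') :
    tens U V -> tens U' V' :=
  tlift (fun u v => tpure (f u) (g v)).

Definition tmap2 (U U' U'' V V' V'' : lmodType F)
    (f : U -> U' -> U'') (g : V -> V' -> V'')
    (s : tens U V) (t : tens U' V') : tens U'' V'' :=
  tlift (fun u v => tlift (fun u' v' => tpure (f u u') (g v v')) t) s.

Definition tassoc (U V W : lmodType F) :
    tens U (tens V W) -> tens (tens U V) W :=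
  tlift (fun u t => tlift (fun v w => tpure (tpure u v) w) t).

Section Rules.
Variables U V U' V' U'' V'' : lmodType F.

Lemma tmap_pure (f : U -> U') (g : V -> V') u v : linear f -> linear g ->
  tmap f g (tpure u v) = tpure (f u) (g v).
Proof.
move=> lf lg; rewrite /tmap tlift_pure//.
exact: (bilin_pre lf lg (tpure_bilin _ _)).
Qed.

Lemma tmap_linear (f : U -> U') (g : V -> V') : linear f -> linear g ->
  linear (tmap f g).
Proof.
move=> lf lg; apply: tlift_linear.
exact: (bilin_pre lf lg (tpure_bilin _ _)).
Qed.

Lemma tmap2_param (f : U -> U' -> U'') (g : V -> V' -> V'') t :
  bilin f -> bilin g ->
  bilin (fun u v => tlift (fun u' v' => tpure (f u u') (g v v')) t).
Proof.
move=> bf bg.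
have b1 u v : bilin (fun u' v' => tpure (f u u') (g v v')).
  exact: (bilin_pre (bf.2 u) (bg.2 v) (tpure_bilin _ _)).
split=> [v | u]; apply: tlift_param => // u' v' a x y /=.
  by rewrite (bf.1 u') (tpure_bilin _ _).1.
by rewrite (bg.1 v') (tpure_bilin _ _).2.
Qed.

Lemma tmap2_bilin (f : U -> U' -> U'') (g : V -> V' -> V'') :
  bilin f -> bilin g -> bilin (tmap2 f g).
Proof.
move=> bf bg; apply: bilin_flip; apply: tlift_bilin => [t | u v].
  exact: tmap2_param.
apply: tlift_linear.
exact: (bilin_pre (bf.2 u) (bg.2 v) (tpure_bilin _ _)).
Qed.

Lemma tmap2_pure (f : U -> U' -> U'') (g : V -> V' -> V'') u v u' v' :
  bilin f -> bilin g ->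
  tmap2 f g (tpure u v) (tpure u' v') = tpure (f u u') (g v v').
Proof.
move=> bf bg; rewrite /tmap2 tlift_pure; last exact: tmap2_param.
by rewrite tlift_pure//; exact: (bilin_pre (bf.2 u) (bg.2 v) (tpure_bilin _ _)).
Qed.

Lemma tassoc_bilin :
  bilin (fun (u : U) (t : tens V U') =>
    tlift (fun v w => tpure (tpure u v) w) t).
Proof.
apply: tlift_bilin => [u | v w a x y].
  exact: (bilin_pre ((tpure_bilin _ _).2 u) (@linear_idm _ _)
    (tpure_bilin _ _)).
by have /= -> := (tpure_bilin U V).1 v a x y; rewrite (tpure_bilin _ _).1.
Qed.

Lemma tassoc_linear : linear (@tassoc U V U').
Proof. exact: tlift_linear tassoc_bilin. Qed.

Lemma tassoc_pure (u : U) (v : V) (w : U') :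
  tassoc (tpure u (tpure v w)) = tpure (tpure u v) w.
Proof.
rewrite /tassoc tlift_pure ?tlift_pure//; last exact: tassoc_bilin.
exact: (bilin_pre ((tpure_bilin _ _).2 u) (@linear_idm _ _)
  (tpure_bilin _ _)).
Qed.

End Rules.
End TensorMaps.

(* W seen as an F-vector space through iota. *)
Definition restr (F K : fieldType) (iota : {rmorphism F -> K})
  (W : lmodType K) : Type := W.

Section ScalarExtension.
Variables (F K : fieldType) (iota : {rmorphism F -> K}).

Definition semilin (V : lmodType F) (W : lmodType K) (f : V -> W) : Prop :=
  forall a u v, f (a *: u + v) = iota a *: f u + f v.

Local Notation restr := (restr iota).
HB.instance Definition _ (W : lmodType K) := GRing.Zmodule.on (restr W).

Definition restr_scale (W : lmodType K) (a : F) (w : restr W) : restr W :=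
  iota a *: (w : W).

Lemma restr_scaleA (W : lmodType K) a b (w : restr W) :
  restr_scale a (restr_scale b w) = restr_scale (a * b) w.
Proof. by rewrite /restr_scale scalerA -rmorphM. Qed.

Lemma restr_scale1 (W : lmodType K) : left_id 1 (@restr_scale W).
Proof. by move=> w; rewrite /restr_scale rmorph1 scale1r. Qed.

Lemma restr_scaleDr (W : lmodType K) :
  right_distributive (@restr_scale W) +%R.
Proof. by move=> a x y; rewrite /restr_scale scalerDr. Qed.

Lemma restr_scaleDl (W : lmodType K) w :
  {morph (fun a => @restr_scale W a w) : a b / a + b}.
Proof. by move=> a b; rewrite /restr_scale rmorphD scalerDl. Qed.

HB.instance Definition _ (W : lmodType K) :=
  GRing.Zmodule_isLmodule.Build F (restr W) (@restr_scaleA W)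
    (@restr_scale1 W) (@restr_scaleDr W) (@restr_scaleDl W).

(* The extension of scalars of V along iota. *)
Definition ext (V : lmodType F) :=
  presented (fun (W : lmodType K) (f : V -> W) => semilin f).

HB.instance Definition _ (V : lmodType F) := GRing.Lmodule.on (ext V).

Definition inext (V : lmodType F) (v : V) : ext V := generator _ v.

(* The K-linear map ext V -> W extending f; it is only used for semilinear
   f. *)
Definition elift (V : lmodType F) (W : lmodType K) (f : V -> W) :
  ext V -> W := presented_lift f.

Section Universal.
Variables (V : lmodType F) (W : lmodType K).

Lemma elift_in (f : V -> W) v : semilin f -> elift f (inext v) = f v.
Proof. by move=> sf; rewrite /elift presented_lift_gen. Qed.

Lemma elift_linear (f : V -> W) : semilin f -> linear (elift f).
Proof. by move=> sf; exact: presented_lift_linear. Qed.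

Lemma inext_semilin : semilin (@inext V).
Proof.
move=> a x y; apply: presented_eq => X f sf.
by rewrite presented_lift_linear// !presented_lift_gen.
Qed.

Lemma ext_ind (Q : ext V -> Prop) :
  Q 0 -> (forall x y, Q x -> Q y -> Q (x + y)) ->
  (forall c v, Q (c *: inext v)) -> forall x, Q x.
Proof. exact: presented_ind. Qed.

Lemma ext_ext (f g : ext V -> W) : linear f -> linear g ->
  (forall v, f (inext v) = g (inext v)) -> f =1 g.
Proof.
move=> lf lg fg; apply: ext_ind; first by rewrite !linearm0.
  by move=> x y fx fy; rewrite !linearmD// fx fy.
by move=> c v; rewrite !linearmZ// fg.
Qed.

End Universal.

Lemma semilin_restr (V : lmodType F) (W : lmodType K) (f : V -> W) :
  semilin f = linear (f : V -> restr W).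
Proof. by []. Qed.

Lemma semilinmD (V : lmodType F) (W : lmodType K) (f : V -> W) x y :
  semilin f -> f (x + y) = f x + f y.
Proof. by move=> sf; exact: (@linearmD _ _ (restr W) f sf). Qed.

Lemma semilinm0 (V : lmodType F) (W : lmodType K) (f : V -> W) :
  semilin f -> f 0 = 0.
Proof. by move=> sf; exact: (@linearm0 _ _ (restr W) f sf). Qed.

Lemma semilinmZ (V : lmodType F) (W : lmodType K) (f : V -> W) a x :
  semilin f -> f (a *: x) = iota a *: f x.
Proof. by move=> sf; exact: (@linearmZ _ _ (restr W) f sf). Qed.

Lemma semilin_post (V : lmodType F) (W W' : lmodType K)
    (f : W -> W') (g : V -> W) :
  linear f -> semilin g -> semilin (fun v => f (g v)).
Proof. by move=> lf sg a x y; rewrite sg lf. Qed.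

Lemma semilin_pre (V V' : lmodType F) (W : lmodType K)
    (f : V -> W) (g : V' -> V) :
  semilin f -> linear g -> semilin (fun v => f (g v)).
Proof. by move=> sf lg a x y; rewrite lg sf. Qed.

Definition emap (V W : lmodType F) (f : V -> W) : ext V -> ext W :=
  elift (fun v => inext (f v)).

(* The extension of a bilinear map. *)
Definition ebil (U V W : lmodType F) (f : U -> V -> W)
    (x : ext U) (y : ext V) : ext W :=
  elift (fun u => emap (f u) y) x.

(* The canonical map from a tensor product over F to that over K. *)
Definition smap (U V : lmodType F) (U' V' : lmodType K) (f : U -> U')
    (g : V -> V') : tens U V -> tens U' V' :=
  tlift (fun u v => tpure (f u) (g v) : restr (tens U' V')).

Definition text (U V : lmodType F) : tens U V -> tens (ext U) (ext V) :=
  smap (@inext U) (@inext V).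

Lemma tens_sext (U V : lmodType F) (X : lmodType K) (f g : tens U V -> X) :
  semilin f -> semilin g ->
  (forall u v, f (tpure u v) = g (tpure u v)) -> f =1 g.
Proof. exact: (@tens_ext _ _ _ (restr X)). Qed.

Section Rules.
Variables U V W : lmodType F.

Lemma emap_in (f : V -> W) v : linear f -> emap f (inext v) = inext (f v).
Proof.
by move=> lf; rewrite /emap elift_in//; apply/semilin_pre/lf/inext_semilin.
Qed.

Lemma emap_linear (f : V -> W) : linear f -> linear (emap f).
Proof.
by move=> lf; apply: elift_linear; apply/semilin_pre/lf/inext_semilin.
Qed.

Lemma ebil_semilin (f : U -> V -> W) y : bilin f ->
  semilin (fun u => emap (f u) y).
Proof.
move=> bf a u v; elim/ext_ind: y => [|x y IHx IHy|c w].
- by rewrite !(linearm0 (emap_linear (bf.2 _))) scaler0 addr0.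
- rewrite !(linearmD (emap_linear (bf.2 _))) IHx IHy scalerDr.
  by rewrite addrACA.
- rewrite !(linearmZ (emap_linear (bf.2 _))) !(emap_in _ (bf.2 _)).
  rewrite (bf.1 w) inext_semilin scalerDr.
  by rewrite !scalerA mulrC.
Qed.

Lemma ebil_bilin (f : U -> V -> W) : bilin f -> bilin (ebil f).
Proof.
move=> bf; split=> [y | x a y z].
  by apply: elift_linear; exact: ebil_semilin.
elim/ext_ind: x => [|x x' IHx IHx'|c u].
- by rewrite /ebil !(linearm0 (elift_linear (ebil_semilin _ bf))) scaler0 addr0.
- rewrite /ebil !(linearmD (elift_linear (ebil_semilin _ bf))).
  by rewrite -!/(ebil _ _ _) IHx IHx' scalerDr addrACA.
- rewrite /ebil !(linearmZ (elift_linear (ebil_semilin _ bf))).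
  rewrite !elift_in; try exact: ebil_semilin.
  rewrite (emap_linear (bf.2 u)) scalerDr !scalerA.
  by rewrite mulrC.
Qed.

Lemma ebil_in (f : U -> V -> W) u v : bilin f ->
  ebil f (inext u) (inext v) = inext (f u v).
Proof.
move=> bf; rewrite /ebil elift_in; last exact: ebil_semilin.
exact: emap_in (bf.2 u).
Qed.

End Rules.

Section Smap.
Variables U V : lmodType F.

Lemma smap_bilin (U' V' : lmodType K) (f : U -> U') (g : V -> V') :
  semilin f -> semilin g ->
  bilin (fun (u : U) (v : V) => tpure (f u) (g v) : restr (tens U' V')).
Proof.
move=> sf sg; split=> [v a x y | u a x y] /=.
  by rewrite sf; exact: (tpure_bilin _ _).1.
by rewrite sg (tpure_bilin _ _).2.
Qed.

Lemma smap_pure (U' V' : lmodType K) (f : U -> U') (g : V -> V') u v :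
  semilin f -> semilin g -> smap f g (tpure u v) = tpure (f u) (g v).
Proof. by move=> sf sg; rewrite /smap tlift_pure//; exact: smap_bilin. Qed.

Lemma smap_semilin (U' V' : lmodType K) (f : U -> U') (g : V -> V') :
  semilin f -> semilin g -> semilin (smap f g).
Proof. by move=> sf sg; exact: tlift_linear (smap_bilin sf sg). Qed.

Lemma text_pure (u : U) (v : V) :
  text (tpure u v) = tpure (inext u) (inext v).
Proof. by apply: smap_pure; exact: inext_semilin. Qed.

Lemma text_semilin : semilin (@text U V).
Proof. by apply: smap_semilin; exact: inext_semilin. Qed.

End Smap.

Section SmapRules.
Variables U V W : lmodType F.

Lemma tlift_smap (U' V' X : lmodType K) (Y : lmodType F) (f : U' -> V' -> X)
    (g : U -> V -> Y) (a : U -> U') (b : V -> V') (h : Y -> X) t :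
  semilin a -> semilin b -> semilin h -> bilin f -> bilin g ->
  (forall u v, f (a u) (b v) = h (g u v)) ->
  tlift f (smap a b t) = h (tlift g t).
Proof.
move=> sa sb sh bf bg fgh; move: t; apply: tens_sext.
- by apply/semilin_post/smap_semilin => //; exact: tlift_linear.
- by apply/semilin_pre => //; exact: tlift_linear.
- by move=> u v; rewrite smap_pure// !tlift_pure.
Qed.

Lemma tmap_smap (U' V' U2 V2 : lmodType K) (f : U' -> U2) (g : V' -> V2)
    (a : U -> U') (b : V -> V') t :
  semilin a -> semilin b -> linear f -> linear g ->
  tmap f g (smap a b t) = smap (fun u => f (a u)) (fun v => g (b v)) t.
Proof.
move=> sa sb lf lg.
have sfa : semilin (fun u => f (a u)) by exact: semilin_post.
have sgb : semilin (fun v => g (b v)) by exact: semilin_post.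
move: t; apply: tens_sext.
- by apply/semilin_post/smap_semilin => //; exact: tmap_linear.
- exact: smap_semilin.
- by move=> u v; rewrite !smap_pure// tmap_pure.
Qed.

Lemma smap_tmap (U1 V1 : lmodType F) (U' V' : lmodType K) (f : U1 -> U)
    (g : V1 -> V) (a : U -> U') (b : V -> V') t :
  semilin a -> semilin b -> linear f -> linear g ->
  smap a b (tmap f g t) = smap (fun u => a (f u)) (fun v => b (g v)) t.
Proof.
move=> sa sb lf lg.
have saf : semilin (fun u => a (f u)) by exact: semilin_pre.
have sbg : semilin (fun v => b (g v)) by exact: semilin_pre.
move: t; apply: tens_sext.
- by apply/semilin_pre/tmap_linear => //; exact: smap_semilin.
- exact: smap_semilin.
- by move=> u v; rewrite tmap_pure// !smap_pure.
Qed.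

Lemma eq_smap (U' V' : lmodType K) (a a' : U -> U') (b b' : V -> V') :
  a =1 a' -> b =1 b' -> smap a b = smap a' b'.
Proof. by move=> /funext-> /funext->. Qed.

End SmapRules.

Section MoreRules.
Variables U V U1 V1 U2 V2 W : lmodType F.

Lemma text_tmap2 (f : U -> U1 -> U2) (g : V -> V1 -> V2) s t :
  bilin f -> bilin g ->
  text (tmap2 f g s t) = tmap2 (ebil f) (ebil g) (text s) (text t).
Proof.
move=> bf bg; have bf' := ebil_bilin bf; have bg' := ebil_bilin bg.
have b2 := tmap2_bilin bf bg; have b2' := tmap2_bilin bf' bg'.
move: s; apply: tens_sext.
- exact: semilin_pre (@text_semilin _ _) (b2.1 t).
- exact: semilin_post (b2'.1 (text t)) (@text_semilin _ _).
- move=> u v; move: t; apply: tens_sext.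
  + exact: semilin_pre (@text_semilin _ _) (b2.2 _).
  + exact: semilin_post (b2'.2 _) (@text_semilin _ _).
  + by move=> u' v'; rewrite tmap2_pure// !text_pure tmap2_pure// !ebil_in.
Qed.

Lemma tassoc_smap (s : tens U (tens V W)) :
  tassoc (smap (@inext U) (@text V W) s) =
  smap (@text U V) (@inext W) (tassoc s).
Proof.
have j X := @inext_semilin X; have j2 X Y := @text_semilin X Y.
have l F' X Y Z := @tassoc_linear F' X Y Z.
have s1 := smap_semilin (j U) (j2 V W).
have s2 := smap_semilin (j2 U V) (j W).
elim/tens_ind: s => [|s t IHs IHt|u t].
- by rewrite (semilinm0 s1) !(linearm0 (l _ _ _ _)) (semilinm0 s2).
- rewrite (semilinmD _ _ s1) !(linearmD (l _ _ _ _)) IHs IHt.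
  by rewrite (semilinmD _ _ s2).
rewrite smap_pure//; move: t; apply: tens_sext.
- exact: semilin_post (l _ _ _ _)
    (semilin_post ((tpure_bilin _ _).2 _) (j2 _ _)).
- apply: semilin_pre (smap_semilin (j2 _ _) (j _)) _.
  exact: linear_comp (l _ _ _ _) ((tpure_bilin _ _).2 _).
- by move=> v w; rewrite tassoc_pure smap_pure// !text_pure tassoc_pure.
Qed.

End MoreRules.
End ScalarExtension.

Section Groups.
Variable F : fieldType.

(* An affine group scheme of finite type over F, given by its coordinate
   Hopf algebra; comul f is the function (x, y) |-> f (x * y). *)
Record algGroup := AlgGroup {
  coord : comAlgType F;
  comul : coord -> tens coord coord;
  counit : coord -> F;
  antipode : coord -> coord;
  comul_linear : linear comul;
  comulM : forall a b, comul (a * b) = tmap2 *%R *%R (comul a) (comul b);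
  comul1 : comul 1 = tpure 1 1;
  counit_linear : scalar counit;
  counitM : {morph counit : a b / a * b};
  counit1 : counit 1 = 1;
  antipode_linear : linear antipode;
  comulA : forall a, tassoc (tmap id comul (comul a)) = tmap comul id (comul a);
  comul_counitl : forall a, tlift (fun b c => counit b *: c) (comul a) = a;
  comul_counitr : forall a, tlift (fun b c => counit c *: b) (comul a) = a;
  comul_antipodel : forall a,
    tlift (fun b c => antipode b * c) (comul a) = (counit a)%:A;
  comul_antipoder : forall a,
    tlift (fun b c => b * antipode c) (comul a) = (counit a)%:A;
  coord_finite_type : exists s : seq coord, forall S : {pred coord},
    GRing.subalg_closed S -> {subset s <= S} -> forall a, a \in S }.

(* A rational representation of B on V is a right comodule: if
   coact v = \sum_i v_i (x) a_i, then g acts by g v = \sum_i a_i(g) v_i. *)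
Record rep (B : algGroup) (V : lmodType F) := Rep {
  coact : V -> tens V (coord B);
  coact_linear : linear coact;
  coactA : forall v,
    tassoc (tmap id (@comul B) (coact v)) = tmap coact id (coact v);
  coact_counit : forall v, tlift (fun w a => counit a *: w) (coact v) = v }.

Definition hom_rep (B : algGroup) (V W : lmodType F) (r : rep B V)
    (r' : rep B W) : set (V -> W) :=
  [set f | linear f /\ forall v, coact r' (f v) = tmap f id (coact r v)].

(* A linear subspace S of W is finite-dimensional. *)
Definition finite_dim (W : lmodType F) (S : set W) : Prop :=
  exists (n : nat) (e : 'I_n -> W), (forall i, S (e i)) /\
    forall w, S w -> exists c : 'I_n -> F, w = \sum_i c i *: e i.

(* Every vector lies in a finite-dimensional subrepresentation, here the span
   of the e i. *)
Definition locally_finite (B : algGroup) (V : lmodType F) (r : rep B V) :=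
  forall v, exists (n : nat) (e : 'I_n -> V),
    (exists c : 'I_n -> F, v = \sum_i c i *: e i) /\
    forall i, exists a : 'I_n -> coord B,
      coact r (e i) = \sum_j tpure (e j) (a j).

(* The Lie algebra of B: the point derivations of the coordinate algebra at
   the identity. *)
Definition point_derivation (B : algGroup) (d : coord B -> F) : Prop :=
  scalar d /\ forall a b, d (a * b) = counit a * d b + d a * counit b.

Definition derivations (B : algGroup) : {pred coord B -> F^o} :=
  [pred d | `[< point_derivation d >]].

Lemma derivations_submod (B : algGroup) : submod_closed (@derivations B).
Proof.
split=> [|c d d' /asboolP[ld Ld] /asboolP[ld' Ld']]; apply/asboolP; split.
- by move=> a x y; rewrite /= mulr0 addr0.
- by move=> a b; rewrite /= mulr0 mul0r addr0.
- move=> a x y; change (c * d (a *: x + y) + d' (a *: x + y) =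
    a * (c * d x + d' x) + (c * d y + d' y)).
  rewrite ld ld' !mulrDr addrACA; congr (_ + _ + (_ + _)).
  by rewrite mulrCA.
- move=> a b; change (c * d (a * b) + d' (a * b) =
    counit a * (c * d b + d' b) + (c * d a + d' a) * counit b).
  rewrite Ld Ld' !mulrDr mulrDl addrACA; congr (_ + _ + (_ + _)).
    by rewrite mulrCA.
  by rewrite mulrA.
Qed.

HB.instance Definition _ (B : algGroup) :=
  GRing.isSubmodClosed.Build F (coord B -> F^o) (@derivations B)
    (@derivations_submod B).

Record lie (B : algGroup) :=
  Lie { lie_fun : coord B -> F^o; lieP : lie_fun \in @derivations B }.
HB.instance Definition _ (B : algGroup) := [isSub for @lie_fun B].
HB.instance Definition _ (B : algGroup) := [Choice of lie B by <:].
HB.instance Definition _ (B : algGroup) :=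
  [SubChoice_isSubLmodule of lie B by <:].

Lemma lie_derivation (B : algGroup) (d : lie B) : point_derivation (lie_fun d).
Proof. by apply/asboolP; exact: lieP. Qed.

Lemma counit_bilin (B : algGroup) (V : lmodType F) :
  bilin (fun (v : V) (a : coord B) => counit a *: v).
Proof.
split=> [v a x y | v a x y]; first by rewrite scalerDr !scalerA mulrC.
by rewrite counit_linear scalerDl scalerA.
Qed.

Lemma scalar_bilin (U V : lmodType F) (f : U -> F) (g : V -> F) :
  scalar f -> scalar g -> bilin (fun u v => f u * g v : F^o).
Proof.
move=> lf lg; split=> [v a x y | u a x y] /=.
  by rewrite lf mulrDl -mulrA.
by rewrite lg mulrDr mulrCA.
Qed.

(* The convolution product (d (x) d') o comul. *)
Definition convol (B : algGroup) (d d' : coord B -> F) (a : coord B) : F^o :=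
  tlift (fun b c => d b * d' c : F^o) (comul a).

Section Convol.
Variable B : algGroup.
Implicit Types p q : coord B -> F.

Lemma convol_linear p q : scalar p -> scalar q -> scalar (convol p q).
Proof.
move=> lp lq.
exact: linear_comp (tlift_linear (scalar_bilin lp lq)) (@comul_linear B).
Qed.

Lemma convol_counitl q a : scalar q -> convol (@counit B) q a = q a.
Proof.
move=> lq; rewrite -[in RHS](comul_counitl a) /convol.
have le := @counit_linear B.
have be := bilin_flip (counit_bilin B (coord B)).
move: (comul a); apply: tens_ext.
- exact: tlift_linear (scalar_bilin le lq).
- exact: linear_comp (lq : linear (q : coord B -> F^o)) (tlift_linear be).
- move=> b c; rewrite !tlift_pure//; last exact: scalar_bilin.
  by rewrite (linearmZ (lq : linear (q : coord B -> F^o))).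
Qed.

Lemma convol_counitr p a : scalar p -> convol p (@counit B) a = p a.
Proof.
move=> lp; rewrite -[in RHS](comul_counitr a) /convol.
have le := @counit_linear B.
have be := counit_bilin B (coord B).
move: (comul a); apply: tens_ext.
- exact: tlift_linear (scalar_bilin lp le).
- exact: linear_comp (lp : linear (p : coord B -> F^o)) (tlift_linear be).
- move=> b c; rewrite !tlift_pure//; last exact: scalar_bilin.
  by rewrite (linearmZ (lp : linear (p : coord B -> F^o))) mulrC.
Qed.

Lemma convol_derivM p q a b : point_derivation p -> point_derivation q ->
  convol p q (a * b) = counit a * convol p q b + q a * p b + p a * q b
    + convol p q a * counit b.
Proof.
move=> [lp Lp] [lq Lq]; have le := @counit_linear B.
pose L (x y : coord B -> F) := tlift (fun b c => x b * y c : F^o).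
have lL x y : scalar x -> scalar y -> linear (L x y).
  by move=> lx ly; exact: tlift_linear (scalar_bilin lx ly).
have pL x y u v : scalar x -> scalar y -> L x y (tpure u v) = x u * y v.
  by move=> lx ly; rewrite /L tlift_pure//; exact: scalar_bilin.
have bM : bilin (fun x y : coord B => x * y).
  split=> [v c x y | u c x y]; first by rewrite mulrDl scalerAl.
  by rewrite mulrDr scalerAr.
have bMM := tmap2_bilin bM bM.
have key s t : L p q (tmap2 *%R *%R s t) =
    L (@counit B) (@counit B) s * L p q t + L (@counit B) q s * L p (@counit B) t
    + L p (@counit B) s * L (@counit B) q t
    + L p q s * L (@counit B) (@counit B) t.
  elim/tens_ind: s => [|s s' IHs IHs'|u v].
  - rewrite (linearm0 (bMM.1 t)).
    by rewrite !(linearm0 (lL _ _ _ _))// !mul0r !addr0.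
  - rewrite (linearmD (bMM.1 t)) !(linearmD (lL _ _ _ _))// IHs IHs'.
    by ring.
  - elim/tens_ind: t => [|t t' IHt IHt'|u' v'].
    + rewrite (linearm0 (bMM.2 _)).
      by rewrite !(linearm0 (lL _ _ _ _))// !mulr0 !addr0.
    + rewrite (linearmD (bMM.2 _)) !(linearmD (lL _ _ _ _))// IHt IHt'.
      by ring.
    + by rewrite tmap2_pure// !pL// Lp Lq; ring.
have le2 c : convol (@counit B) (@counit B) c = counit c.
  exact: convol_counitl.
rewrite -(le2 a) -(le2 b) -(convol_counitl a lq) -(convol_counitl b lq).
rewrite -(convol_counitr a lp) -(convol_counitr b lp) /convol comulM.
exact: key.
Qed.

End Convol.

Lemma lie_bracket_subproof (B : algGroup) (d d' : lie B) :
  (fun a => convol (lie_fun d) (lie_fun d') a - convol (lie_fun d') (lie_fun d) a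
     : F^o) \in @derivations B.
Proof.
have Dd := lie_derivation d; have Dd' := lie_derivation d'.
apply/asboolP; split=> [c x y | a b].
  rewrite /= (convol_linear Dd.1 Dd'.1) (convol_linear Dd'.1 Dd.1).
  by ring.
by rewrite /= !convol_derivM//; ring.
Qed.

Definition lie_bracket (B : algGroup) (d d' : lie B) : lie B :=
  Lie (lie_bracket_subproof d d').

End Groups.

Section AlgebraExtension.
Variables (F K : fieldType) (iota : {rmorphism F -> K}).

Section Ring.
Variable A : comAlgType F.

Lemma mul_bilin : bilin (fun x y : A => x * y).
Proof.
split=> [v c x y | u c x y]; first by rewrite mulrDl scalerAl.
by rewrite mulrDr scalerAr.
Qed.

Let emul : ext iota A -> ext iota A -> ext iota A := ebil (fun x y : A => x * y).
Let eone : ext iota A := inext iota 1.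

Let emul_bilin : bilin emul. Proof. exact: ebil_bilin mul_bilin. Qed.

Let emul_in a b : emul (inext iota a) (inext iota b) = inext iota (a * b).
Proof. exact: ebil_in mul_bilin. Qed.

Lemma ext_mulC : commutative emul.
Proof.
have [bl br] := emul_bilin.
move=> x y; move: x; apply: ext_ext; [exact: bl | exact: br |] => a.
move: y; apply: ext_ext; [exact: br | exact: bl |] => b.
by rewrite !emul_in mulrC.
Qed.

Lemma ext_mulA : associative emul.
Proof.
have [bl br] := emul_bilin.
move=> x y z; move: x; apply: ext_ext => [||a].
- exact: bl.
- exact: linear_comp (bl z) (bl y).
move: y; apply: ext_ext => [||b].
- exact: linear_comp (br _) (bl z).
- exact: linear_comp (bl z) (br _).
move: z; apply: ext_ext => [||c].
- exact: linear_comp (br _) (br _).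
- exact: br.
by rewrite !emul_in mulrA.
Qed.

Lemma ext_mul1 : left_id eone emul.
Proof.
have [bl br] := emul_bilin.
apply: ext_ext => [||a]; [exact: br | by [] |].
by rewrite emul_in mul1r.
Qed.

Lemma ext_mulDl : left_distributive emul +%R.
Proof.
have [bl br] := emul_bilin => x y z.
exact: linearmD (bl z) x y.
Qed.

HB.instance Definition _ := GRing.Zmodule_isComPzRing.Build (ext iota A)
  ext_mulA ext_mulC ext_mul1 ext_mulDl.

Lemma inextM a b : inext iota (a * b) = inext iota a * inext iota b :> ext iota A.
Proof. by rewrite -emul_in. Qed.

Lemma inext1 : inext iota 1 = 1 :> ext iota A.
Proof. by []. Qed.

Lemma ext_mulE (x y : ext iota A) : x * y = ebil (fun x y : A => x * y) x y.
Proof. by []. Qed.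

Lemma ext_scalerAl c (x y : ext iota A) : c *: (x * y) = (c *: x) * y.
Proof. by have [bl _] := emul_bilin; exact/esym/(linearmZ (bl y)). Qed.

End Ring.

Variable B : algGroup F.

Lemma iota_counit_semilin :
  semilin iota (fun a : coord B => iota (counit a) : K^o).
Proof. by move=> c x y; rewrite counit_linear rmorphD rmorphM. Qed.

Lemma ext_coord_oner_neq0 : 1 != 0 :> ext iota (coord B).
Proof.
apply/eqP => /(congr1 (elift (fun a : coord B => iota (counit a) : K^o))).
rewrite -inext1 elift_in; last exact: iota_counit_semilin.
rewrite (linearm0 (elift_linear iota_counit_semilin)) counit1 rmorph1.
by move/eqP; rewrite oner_eq0.
Qed.

HB.instance Definition _ := GRing.PzSemiRing_isNonZero.Build
  (ext iota (coord B)) ext_coord_oner_neq0.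
HB.instance Definition _ := GRing.Lmodule_isLalgebra.Build K
  (ext iota (coord B)) (@ext_scalerAl (coord B)).
HB.instance Definition _ := GRing.Lalgebra_isComAlgebra.Build K
  (ext iota (coord B)).
End AlgebraExtension.

Section GroupExtension.
Variables (F K : fieldType) (iota : {rmorphism F -> K}) (B : algGroup F).

Notation A := (coord B).
Notation A' := (ext iota (coord B)).
Notation j := (@inext F K iota _).

Definition ext_comul : A' -> tens A' A' :=
  elift (fun a => text iota (comul a)).
Definition ext_counit : A' -> K := elift (fun a => iota (counit a) : K^o).
Definition ext_antipode : A' -> A' := emap (@antipode F B).

Definition ext_coact (V : lmodType F) (r : rep B V) :
    ext iota V -> tens (ext iota V) A' :=
  elift (fun v => text iota (coact r v)).

Let sj (V : lmodType F) : semilin iota (@inext F K iota V).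
Proof. exact: inext_semilin. Qed.
Let st (U V : lmodType F) : semilin iota (@text F K iota U V).
Proof. exact: text_semilin. Qed.
Let ll (V : lmodType K) := @linear_idm K V.

Section Coact.
Variables (V : lmodType F) (rho : V -> tens V A).
Hypothesis lrho : linear rho.
Let rho' : ext iota V -> tens (ext iota V) A' :=
  elift (fun v => text iota (rho v)).

Let srho : semilin iota (fun v => text iota (rho v)).
Proof. exact: semilin_pre (@st _ _) lrho. Qed.

Let lrho' : linear rho'. Proof. exact: elift_linear. Qed.

Let rho'_in v : rho' (j v) = text iota (rho v).
Proof. exact: elift_in. Qed.

Lemma ext_comul_semilin : semilin iota (fun a => text iota (@comul F B a)).
Proof. exact: semilin_pre (@st _ _) (@comul_linear _ B). Qed.

Lemma ext_comul_linear : linear ext_comul.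
Proof. exact: elift_linear ext_comul_semilin. Qed.

Lemma ext_comul_in a : ext_comul (j a) = text iota (comul a).
Proof. exact: elift_in ext_comul_semilin. Qed.

Lemma ext_counit_linear : scalar ext_counit.
Proof. exact: elift_linear (@iota_counit_semilin _ _ iota B). Qed.

Lemma ext_counit_in a : ext_counit (j a) = iota (counit a).
Proof. exact: elift_in (@iota_counit_semilin _ _ iota B). Qed.

Lemma ext_coactA :
  (forall v, tassoc (tmap id (@comul F B) (rho v)) = tmap rho id (rho v)) ->
  forall x, tassoc (tmap id ext_comul (rho' x)) = tmap rho' id (rho' x).
Proof.
move=> rA.
have l1 := tmap_linear (@ll _) ext_comul_linear.
have l2 := tmap_linear lrho' (@ll _).
apply: ext_ext => [||v].
- exact: linear_comp (@tassoc_linear _ _ _ _) (linear_comp (l1 _) lrho').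
- exact: linear_comp (l2 _) lrho'.
rewrite rho'_in (tmap_smap _ (@sj _) (@sj _) (@ll _) ext_comul_linear).
rewrite (tmap_smap _ (@sj _) (@sj _) lrho' (@ll _)).
rewrite (eq_smap iota (fun=> erefl) ext_comul_in).
rewrite (eq_smap iota rho'_in (fun=> erefl)).
have le := linear_idm.
rewrite -(smap_tmap _ (@sj _) (@st _ _) (le _ _) (@comul_linear _ B)).
rewrite -(smap_tmap _ (@st _ _) (@sj _) lrho (le _ _)) -rA.
exact: tassoc_smap.
Qed.

Lemma ext_coact_counit :
  (forall v, tlift (fun w a => counit a *: w) (rho v) = v) ->
  forall x, tlift (fun w a => ext_counit a *: w) (rho' x) = x.
Proof.
move=> rc.
have b1 := counit_bilin B V.
have b2 : bilin (fun (w : ext iota V) (a : A') => ext_counit a *: w).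
  split=> [v a x y | v a x y]; first by rewrite scalerDr !scalerA mulrC.
  by rewrite ext_counit_linear scalerDl scalerA.
apply: ext_ext => [||v].
- exact: linear_comp (tlift_linear b2) lrho'.
- exact: linear_idm.
rewrite rho'_in /text (tlift_smap _ (@sj _) (@sj _) (@sj _) b2 b1) ?rc//.
by move=> w a; rewrite ext_counit_in (semilinmZ _ _ (@sj _)).
Qed.

End Coact.

Let Al := mul_bilin A.
Let lc := @comul_linear _ B.

Lemma ext_comulM (a b : A') :
  ext_comul (a * b) = tmap2 *%R *%R (ext_comul a) (ext_comul b).
Proof.
have [ml mr] : bilin (fun a b : A' => a * b) by exact: ebil_bilin Al.
have [tl tr] := tmap2_bilin (ebil_bilin iota Al) (ebil_bilin iota Al).
have lc' := ext_comul_linear.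
move: a; apply: ext_ext => [||a].
- exact: linear_comp lc' (ml b).
- exact: linear_comp (tl _) lc'.
move: b; apply: ext_ext => [||b].
- exact: linear_comp lc' (mr _).
- exact: linear_comp (tr _) lc'.
by rewrite -inextM !ext_comul_in comulM text_tmap2.
Qed.

Lemma ext_comul1 : ext_comul 1 = tpure 1 1.
Proof. by rewrite -inext1 ext_comul_in comul1 text_pure. Qed.

Lemma ext_counitM : {morph ext_counit : a b / a * b}.
Proof.
have [ml mr] : bilin (fun a b : A' => a * b) by exact: ebil_bilin Al.
have le : linear (ext_counit : A' -> K^o) by exact: ext_counit_linear.
move=> a b; move: a; apply: (@ext_ext _ _ _ _ K^o) => [||a].
- exact: linear_comp le (ml b).
- by move=> c x y; rewrite le mulrDl -mulrA.
move: b; apply: (@ext_ext _ _ _ _ K^o) => [||b].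
- exact: linear_comp le (mr _).
- by move=> c x y; rewrite le mulrDr mulrCA.
by rewrite -inextM !ext_counit_in counitM rmorphM.
Qed.

Lemma ext_counit1 : ext_counit 1 = 1.
Proof. by rewrite -inext1 ext_counit_in counit1 rmorph1. Qed.

Lemma ext_antipode_linear : linear ext_antipode.
Proof. exact: emap_linear (@antipode_linear _ B). Qed.

Lemma ext_antipode_in a : ext_antipode (j a) = j (antipode a).
Proof. exact: emap_in (@antipode_linear _ B). Qed.

Lemma alg_counit_linear (G : comAlgType K) (e : A' -> K) :
  scalar e -> linear (fun x => (e x)%:A : G).
Proof. by move=> le c x y; rewrite le scalerDl scalerA. Qed.

Lemma ext_antipodel (a : A') :
  tlift (fun b c => ext_antipode b * c) (ext_comul a) = (ext_counit a)%:A.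
Proof.
have bA' : bilin (fun a b : A' => a * b) by exact: ebil_bilin Al.
have b1 := bilin_pre (@antipode_linear _ B) (@linear_idm _ _) Al.
have b2 := bilin_pre ext_antipode_linear (@ll _) bA'.
move: a; apply: ext_ext => [||a].
- exact: linear_comp (tlift_linear b2) ext_comul_linear.
- exact: alg_counit_linear ext_counit_linear.
rewrite ext_comul_in /text (tlift_smap _ (@sj _) (@sj _) (@sj _) b2 b1).
  by rewrite comul_antipodel (semilinmZ _ _ (@sj _)) ext_counit_in inext1.
by move=> u v; rewrite ext_antipode_in -inextM.
Qed.

Lemma ext_antipoder (a : A') :
  tlift (fun b c => b * ext_antipode c) (ext_comul a) = (ext_counit a)%:A.
Proof.
have bA' : bilin (fun a b : A' => a * b) by exact: ebil_bilin Al.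
have b1 := bilin_pre (@linear_idm _ _) (@antipode_linear _ B) Al.
have b2 := bilin_pre (@ll _) ext_antipode_linear bA'.
move: a; apply: ext_ext => [||a].
- exact: linear_comp (tlift_linear b2) ext_comul_linear.
- exact: alg_counit_linear ext_counit_linear.
rewrite ext_comul_in /text (tlift_smap _ (@sj _) (@sj _) (@sj _) b2 b1).
  by rewrite comul_antipoder (semilinmZ _ _ (@sj _)) ext_counit_in inext1.
by move=> u v; rewrite ext_antipode_in -inextM.
Qed.

Lemma ext_counitl (a : A') :
  tlift (fun b c => ext_counit b *: c) (ext_comul a) = a.
Proof.
have b1 := bilin_flip (counit_bilin B A).
have b2 : bilin (fun b c : A' => ext_counit b *: c).
  split=> [v c x y | v c x y]; last by rewrite scalerDr !scalerA mulrC.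
  by rewrite ext_counit_linear scalerDl scalerA.
move: a; apply: ext_ext => [||a].
- exact: linear_comp (tlift_linear b2) ext_comul_linear.
- exact: linear_idm.
rewrite ext_comul_in /text (tlift_smap _ (@sj _) (@sj _) (@sj _) b2 b1).
  by rewrite comul_counitl.
by move=> b c; rewrite ext_counit_in (semilinmZ _ _ (@sj _)).
Qed.

Lemma ext_finite_type : exists s : seq A', forall S : {pred A'},
  GRing.subalg_closed S -> {subset s <= S} -> forall a, a \in S.
Proof.
have [s hs] := coord_finite_type B.
exists [seq j a | a <- s] => S [S1 SL SM] sS.
have inS a : j a \in S.
  pose T : {pred A} := [pred a | j a \in S].
  suff : a \in T by [].
  apply: hs => [|b bs]; last by rewrite inE; apply: sS; apply: map_f.
  split; rewrite ?inE.
  - exact: S1.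
  - by move=> c u v; rewrite !inE => hu hv; rewrite (@sj _) SL.
  - by move=> u v; rewrite !inE => hu hv; rewrite inextM SM.
have S0 : 0 \in S by rewrite -(subrr 1) -scaleN1r addrC; exact: SL.
apply: ext_ind => //.
- by move=> x y hx hy; rewrite -[x]scale1r; exact: SL.
- by move=> c v; rewrite -[_ *: _]addr0; exact: SL.
Qed.

(* B x_{Spec F} Spec K *)
Definition ext_group : algGroup K :=
  AlgGroup ext_comul_linear ext_comulM ext_comul1 ext_counit_linear
    ext_counitM ext_counit1 ext_antipode_linear
    (ext_coactA lc (@comulA _ B)) ext_counitl
    (ext_coact_counit lc (@comul_counitr _ B))
    ext_antipodel ext_antipoder ext_finite_type.

Section ExtRep.
Variables (V : lmodType F) (r : rep B V).

Lemma ext_coact_linear : linear (ext_coact r).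
Proof.
exact: elift_linear (semilin_pre (@st _ _) (@coact_linear _ _ _ r)).
Qed.

Lemma ext_coact_in v : ext_coact r (j v) = text iota (coact r v).
Proof.
exact: elift_in (semilin_pre (@st _ _) (@coact_linear _ _ _ r)).
Qed.

Definition ext_rep : rep ext_group (ext iota V) :=
  @Rep K ext_group (ext iota V) (ext_coact r) ext_coact_linear
    (ext_coactA (@coact_linear _ _ _ r) (@coactA _ _ _ r))
    (ext_coact_counit (@coact_linear _ _ _ r) (@coact_counit _ _ _ r)).

Lemma ext_rep_locally_finite : locally_finite r -> locally_finite ext_rep.
Proof.
move=> lfr; apply: ext_ind.
- exists 0%N, (fun=> 0); split; last by case.
  by exists (fun=> 0); rewrite big_ord0.
- move=> x y [n [e [[c xE] eE]]] [m [f [[d yE] fE]]].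
  pose g (i : 'I_(n + m)) := match fintype.split i with inl i => e i | inr i => f i end.
  exists (n + m)%N, g; split.
    exists (fun i : 'I_(n + m) => match fintype.split i with inl i => c i | inr i => d i end).
    rewrite big_split_ord /= xE yE; congr (_ + _); apply: eq_bigr => i _.
      by rewrite /g (unsplitK (inl i)).
    by rewrite /g (unsplitK (inr i)).
  move=> i; rewrite /g; case: (fintype.split i) => k; rewrite -/g.
    have [a aE] := eE k.
    exists (fun i : 'I_(n + m) => match fintype.split i with inl i => a i | inr i => 0 end).
    rewrite aE big_split_ord /= [X in _ = _ + X]big1 ?addr0 => [|l _].
      by apply: eq_bigr => l _; rewrite (unsplitK (inl l)).
    rewrite (unsplitK (inr l)).
    exact: (linearm0 ((tpure_bilin _ _).2 _)).
  have [a aE] := fE k.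
  exists (fun i : 'I_(n + m) => match fintype.split i with inl i => 0 | inr i => a i end).
  rewrite aE big_split_ord /= [X in _ = X + _]big1 ?add0r => [|l _].
    by apply: eq_bigr => l _; rewrite (unsplitK (inr l)).
  rewrite (unsplitK (inl l)).
  exact: (linearm0 ((tpure_bilin _ _).2 _)).
- move=> k v; have [n [e [[c vE] eE]]] := lfr v.
  exists n, (fun i => j (e i)); split.
    exists (fun i => k * iota (c i)).
    rewrite vE (@linearm_sum _ _ (restr iota _) _ (@sj V)) scaler_sumr.
    by apply: eq_bigr => i _; rewrite (semilinmZ _ _ (@sj _)) scalerA.
  move=> i; have [a aE] := eE i; exists (fun l => j (a l)).
  rewrite /= ext_coact_in aE (@linearm_sum _ _ (restr iota _) _ (@st _ _)).
  by apply: eq_bigr => l _; rewrite text_pure.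
Qed.

End ExtRep.
End GroupExtension.

Section Pairs.
Variable F : fieldType.

Record lieAlgebra := LieAlgebra {
  lie_space :> vectType F;
  bracket : lie_space -> lie_space -> lie_space;
  bracket_bilin : bilin bracket;
  bracketxx : forall x, bracket x x = 0;
  jacobi : forall x y z,
    bracket x (bracket y z) + bracket y (bracket z x)
      + bracket z (bracket x y) = 0 }.

(* The differential of a representation: d acts by (id (x) d) o coact. *)
Definition differential (B : algGroup F) (V : lmodType F) (r : rep B V)
    (d : lie B) (v : V) : V :=
  tlift (fun w a => (lie_fun d a : F) *: w) (coact r v).

(* The data of a pair (a, B); the conditions on B alone are kept apart, in
   is_pair, as they are not needed to form scalar extensions. *)
Record pair_data := PairData {
  group : algGroup F;
  algebra : lieAlgebra;
  emb : lie group -> algebra;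
  emb_linear : linear emb;
  emb_inj : injective emb;
  emb_bracket : forall d d',
    emb (lie_bracket d d') = bracket (emb d) (emb d');
  action : rep group algebra;
  (* B acts by automorphisms of the Lie algebra *)
  action_bracket : forall x y,
    coact action (bracket x y) =
      tmap2 (@bracket algebra) *%R (coact action x) (coact action y);
  action_differential : forall d x,
    differential action d x = bracket (emb d) x }.

Record pair_module (P : pair_data) := PairModule {
  carrier : lmodType F;
  mrep : rep (group P) carrier;
  mrep_locally_finite : locally_finite mrep;
  mact : algebra P -> carrier -> carrier;
  mact_bilin : bilin mact;
  mact_bracket : forall x y v,
    mact (bracket x y) v = mact x (mact y v) - mact y (mact x v);
  (* g (x v) = (g x) (g v) *)
  mact_equivariant : forall x v,
    coact mrep (mact x v) = tmap2 mact *%R (coact (action P) x) (coact mrep v);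
  mact_differential : forall d v,
    mact (emb d) v = differential mrep d v }.

Definition admissible (P : pair_data) (X : pair_module P) : Prop :=
  forall (V : vectType F) (r : rep (group P) V),
    finite_dim (hom_rep r (mrep X)).

End Pairs.

Import VectorInternalTheory.

Section FreeExtension.
Variables (F K : fieldType) (iota : {rmorphism F -> K}).
Notation j := (@inext F K iota _).

Let sj (V : lmodType F) : semilin iota (@inext F K iota V).
Proof. exact: inext_semilin. Qed.

Section Vect.
Variable V : vectType F.

Let coordK : ext iota V -> 'rV[K]_(dim V) :=
  elift (fun v : V => map_mx iota (v2r v)).

Let coordK_semilin : semilin iota (fun v : V => map_mx iota (v2r v)).
Proof. by move=> a u v; rewrite linearP map_mxD map_mxZ. Qed.

Lemma ext_vect_iso : Vector.axiom (dim V) (ext iota V).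
Proof.
exists coordK; first exact: elift_linear coordK_semilin.
have lc := elift_linear coordK_semilin.
pose g (r : 'rV[K]_(dim V)) : ext iota V :=
  \sum_i r 0 i *: j (r2v (delta_mx 0 i)).
have lg : linear g.
  move=> a x y; rewrite /g scaler_sumr -big_split /=.
  by apply: eq_bigr => i _; rewrite !mxE scalerDl scalerA.
exists g.
  apply: ext_ext => [||v]; [exact: linear_comp lg lc | exact: linear_idm |].
  rewrite /coordK (elift_in _ coordK_semilin) /g.
  rewrite -[in RHS](v2rK v) [in RHS](row_sum_delta (v2r v)) linear_sum.
  rewrite (@linearm_sum _ _ (restr iota _) _ (@sj V)).
  by apply: eq_bigr => i _; rewrite linearZ (semilinmZ _ _ (@sj _)) mxE.
move=> r; rewrite /g /coordK (linearm_sum lc) [RHS]row_sum_delta.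
apply: eq_bigr => i _; rewrite (linearmZ lc) elift_in// r2vK.
by rewrite map_delta_mx.
Qed.

HB.instance Definition _ := Lmodule_hasFinDim.Build K (ext iota V) ext_vect_iso.

End Vect.

Lemma ext_indep (V : lmodType F) (t : ext iota V) :
  exists (n : nat) (c : 'I_n -> K) (v : 'I_n -> V),
    t = \sum_i c i *: j (v i) /\
    forall a : 'I_n -> F, \sum_i iota (a i) * c i = 0 -> forall i, a i = 0.
Proof.
pose Q n := exists (c : 'I_n -> K) (v : 'I_n -> V), t = \sum_i c i *: j (v i).
have exQ : exists n, `[< Q n >].
  elim/ext_ind: t @Q => [|x y|c v].
  - by exists 0%N; apply/asboolP; exists (fun=> 0), (fun=> 0); rewrite big_ord0.
  - move=> [n /asboolP[c [v ->]]] [m /asboolP[d [w ->]]].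
    exists (n + m)%N; apply/asboolP.
    exists (fun i : 'I_(n + m) =>
      match fintype.split i with inl i => c i | inr i => d i end).
    exists (fun i : 'I_(n + m) =>
      match fintype.split i with inl i => v i | inr i => w i end).
    rewrite big_split_ord /=; congr (_ + _); apply: eq_bigr => i _.
      by rewrite (unsplitK (inl i)).
    by rewrite (unsplitK (inr i)).
  - exists 1%N; apply/asboolP; exists (fun=> c), (fun=> v).
    by rewrite big_ord_recl big_ord0 addr0.
case: (ex_minnP exQ) => n /asboolP[c [v tE]] nmin; exists n, c, v; split=> //.
move=> a a0 i; apply/eqP; apply: contraT => ai.
case: n c v tE nmin a a0 i ai => [|n] c v tE nmin a a0 i ai.
  by case: i ai.
suff : (n.+1 <= n)%N by rewrite ltnn.
apply: nmin; apply/asboolP.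
exists (fun l => c (lift i l)).
exists (fun l => v (lift i l) - (a (lift i l) / a i) *: v i).
move: a0; rewrite (bigD1_ord i) //= => /eqP; rewrite addr_eq0 => /eqP ci.
have nz : iota (a i) != 0 by rewrite fmorph_eq0.
have {}ci : c i = - \sum_(l < n) iota (a (lift i l) / a i) * c (lift i l).
  apply: (mulfI nz); rewrite ci mulrN; congr (- _).
  rewrite mulr_sumr; apply: eq_bigr => l _.
  by rewrite mulrA -rmorphM [a i * _]mulrCA divff ?mulr1.
rewrite tE (bigD1_ord i) //= ci scaleNr scaler_suml addrC -sumrB.
apply: eq_bigr => l _.
rewrite (linearmB (@sj V : linear (@inext F K iota V : V -> restr iota _))).
rewrite scalerBr; congr (_ - _).
by rewrite (semilinmZ _ _ (@sj _)) scalerA mulrC.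
Qed.

Lemma linear_inj0 (R : fieldType) (V W : lmodType R) (f : V -> W) :
  linear f -> (forall x, f x = 0 -> x = 0) -> injective f.
Proof.
move=> lf f0 x y fxy; apply/eqP; rewrite -subr_eq0; apply/eqP/f0.
by rewrite (linearmB lf) fxy subrr.
Qed.

Lemma emap_inj (V : lmodType F) (W : vectType F) (f : V -> W) :
  linear f -> injective f -> injective (emap (iota := iota) f).
Proof.
move=> lf f_inj; have lef := @emap_linear F K iota _ _ _ lf.
apply: linear_inj0 => // t; have [n [c [v [-> indep]]]] := ext_indep t.
rewrite (linearm_sum lef) => ft0.
have v0 i : v i = 0.
  apply: f_inj; rewrite (linearm0 lf) -[LHS]v2rK -[RHS]v2rK linear0.
  congr r2v; apply/rowP => k; rewrite mxE; move: i.
  apply: indep.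
  have sc : semilin iota (fun w : W => iota (v2r w 0 k) : K^o).
    by move=> a x y; rewrite linearP !mxE rmorphD rmorphM.
  have lc := elift_linear sc.
  have := congr1 (elift (fun w : W => iota (v2r w 0 k) : K^o)) ft0.
  rewrite (linearm0 lc) (linearm_sum lc) => E; rewrite -[RHS]E.
  apply: eq_bigr => i _.
  by rewrite (linearmZ lef) (linearmZ lc) emap_in// elift_in// mulrC.
by rewrite big1// => i _; rewrite v0 (semilinm0 (@sj _)) scaler0.
Qed.

End FreeExtension.

Section LieExtension.
Variables (F K : fieldType) (iota : {rmorphism F -> K}) (B : algGroup F).
Notation j := (@inext F K iota _).
Notation A := (coord B).
Notation A' := (coord (ext_group iota B)).

Let sj (V : lmodType F) : semilin iota (@inext F K iota V).
Proof. exact: inext_semilin. Qed.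

Lemma lie_fun_linear (R : fieldType) (G : algGroup R) a :
  linear (fun d : lie G => lie_fun d a).
Proof. by move=> c d d'; rewrite -![lie_fun _]/(\val _) linearP. Qed.

Lemma lie_eq (R : fieldType) (G : algGroup R) (d d' : lie G) :
  (forall a, lie_fun d a = lie_fun d' a) -> d = d'.
Proof. by move=> h; apply/val_inj/funext. Qed.

Definition ext_derivation (d : A -> F) : A' -> K^o :=
  elift (fun a => iota (d a) : K^o).

Lemma iota_scalar_semilin (d : A -> F) : scalar d ->
  semilin iota (fun a => iota (d a) : K^o).
Proof. by move=> ld c x y; rewrite ld rmorphD rmorphM. Qed.

Lemma ext_derivation_in (d : A -> F) a : scalar d ->
  ext_derivation d (j a) = iota (d a).
Proof. by move=> ld; apply: elift_in; exact: iota_scalar_semilin. Qed.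

(* A linear form on A' is a derivation as soon as it is one on A. *)
Lemma derivation_ext (d' : A' -> K^o) : linear d' ->
  (forall a b, d' (j (a * b)) =
     iota (counit a) * d' (j b) + d' (j a) * iota (counit b)) ->
  point_derivation d'.
Proof.
move=> ld Ld; split=> // a b.
have [ml mr] := ebil_bilin iota (mul_bilin A).
have le : scalar (@counit _ (ext_group iota B)) by exact: ext_counit_linear.
have sd : scalar d' by [].
move: a; apply: (@ext_ext _ _ _ _ K^o) => [||a].
- exact: linear_comp ld (ml b).
- by move=> c x y; rewrite le sd -[RHS]/(c * _ + _); ring.
move: b; apply: (@ext_ext _ _ _ _ K^o) => [||b].
- exact: linear_comp ld (mr _).
- by move=> c x y; rewrite le sd -[RHS]/(c * _ + _); ring.
by rewrite -inextM Ld /= !ext_counit_in.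
Qed.

Lemma ext_lie_subproof (d : lie B) :
  ext_derivation (lie_fun d) \in @derivations K (ext_group iota B).
Proof.
have [ld Ld] := lie_derivation d.
apply/asboolP; apply: derivation_ext.
  exact: elift_linear (iota_scalar_semilin ld).
by move=> a b; rewrite !ext_derivation_in// Ld rmorphD !rmorphM.
Qed.

(* The canonical map from the scalar extension of Lie(B) to the Lie algebra of
   the scalar extension of B, which is bijective. *)
Definition lie_ext : ext iota (lie B) -> lie (ext_group iota B) :=
  elift (fun d => Lie (ext_lie_subproof d)).

Lemma lie_ext_semilin : semilin iota (fun d => Lie (ext_lie_subproof d)).
Proof.
move=> c d d'; apply: lie_eq => x.
rewrite (lie_fun_linear (G := ext_group iota B) x).
rewrite -[LHS]/(ext_derivation (lie_fun (c *: d + d')) x).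
rewrite -[RHS]/(iota c * ext_derivation (lie_fun d) x
  + ext_derivation (lie_fun d') x).
have ld (e : lie B) := @iota_scalar_semilin (lie_fun e) (lie_derivation e).1.
have le e : scalar (ext_derivation (lie_fun e)) by exact: elift_linear (ld e).
move: x; apply: (@ext_ext _ _ _ _ K^o) => [||a].
- exact: le.
- by move=> k x y; rewrite !le -[RHS]/(k * _ + _); ring.
rewrite !ext_derivation_in; try exact: (lie_derivation _).1.
by rewrite (lie_fun_linear (G := B) a) rmorphD rmorphM.
Qed.

Lemma lie_ext_linear : linear lie_ext.
Proof. exact: elift_linear lie_ext_semilin. Qed.

Lemma lie_ext_in d a :
  lie_fun (lie_ext (j d)) (j a) = iota (lie_fun d a).
Proof.
rewrite /lie_ext elift_in; last exact: lie_ext_semilin.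
exact: ext_derivation_in (lie_derivation d).1.
Qed.

Lemma lie_ext_inj : injective lie_ext.
Proof.
apply: linear_inj0 lie_ext_linear _ => t.
have [n [c [v [-> indep]]]] := ext_indep t => t0.
rewrite big1// => i _.
suff -> : v i = 0 by rewrite (semilinm0 (@sj _)) scaler0.
apply: lie_eq => a; move: i.
have vE d : lie_fun d a = 0 -> lie_fun d a = lie_fun (0 : lie B) a.
  by move=> ->; rewrite (linearm0 (lie_fun_linear (G := B) a)).
move=> i; apply: vE; move: i; apply: indep.
have := congr1 (fun d => @lie_fun K (ext_group iota B) d (j a)) t0.
have l0 := lie_fun_linear (G := ext_group iota B) (j a).
rewrite (linearm0 l0) (linearm_sum lie_ext_linear) (linearm_sum l0) => E.
rewrite -[RHS]E; apply: eq_bigr => i _.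
by rewrite (linearmZ lie_ext_linear) (linearmZ l0) lie_ext_in mulrC.
Qed.

Lemma lie_ext_surj (d' : lie (ext_group iota B)) : exists t, lie_ext t = d'.
Proof.
have [ld' Ld'] := lie_derivation d'.
pose D a : K := lie_fun d' (j a).
have sD : semilin iota (D : A -> K^o).
  by move=> c x y; rewrite /D (@sj A) ld'.
have DM a b : D (a * b) = iota (counit a) * D b + D a * iota (counit b).
  by rewrite /D inextM Ld' /= !ext_counit_in.
pose Q n := exists mu : 'I_n -> K,
  forall a, exists c : 'I_n -> F, D a = \sum_i iota (c i) * mu i.
have exQ : exists n, `[< Q n >].
  have [s hs] := coord_finite_type B.
  exists (size s); apply/asboolP; exists (fun i => D s`_i) => a.
  pose S : {pred A} := [pred a |
    `[< exists c : 'I_(size s) -> F, D a = \sum_i iota (c i) * D s`_i >]].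
  suff /asboolP : a \in S by [].
  apply: hs => [|b bs]; last first.
    apply/asboolP; have ib : (index b s < size s)%N by rewrite index_mem.
    exists (fun i => (i == Ordinal ib)%:R).
    rewrite (bigD1 (Ordinal ib)) //= eqxx rmorph1 mul1r nth_index// big1 ?addr0//.
    by move=> i /negbTE->; rewrite rmorph0 mul0r.
  split.
  - apply/asboolP; exists (fun=> 0).
    rewrite big1 => [|i _]; last by rewrite rmorph0 mul0r.
    have := DM 1 1; rewrite mulr1 counit1 rmorph1 mul1r mulr1.
    by move/eqP; rewrite -subr_eq0 opprD addNKr oppr_eq0 => /eqP.
  - move=> k x y /asboolP[c cE] /asboolP[e eE]; apply/asboolP.
    exists (fun i => k * c i + e i).
    rewrite sD cE eE -[_ *: _]/(_ * _) mulr_sumr -big_split /=.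
    by apply: eq_bigr => i _; rewrite rmorphD rmorphM; ring.
  - move=> x y /asboolP[c cE] /asboolP[e eE]; apply/asboolP.
    exists (fun i => counit x * e i + counit y * c i).
    rewrite DM cE eE mulr_sumr mulr_suml -big_split /=.
    by apply: eq_bigr => i _; rewrite rmorphD !rmorphM; ring.
case: (ex_minnP exQ) => n /asboolP[mu muE] nmin.
have indep (a : 'I_n -> F) : \sum_i iota (a i) * mu i = 0 -> forall i, a i = 0.
  move=> a0 i; apply/eqP; apply: contraT => ai.
  case: n mu muE nmin a a0 i ai => [|n] mu muE nmin a a0 i ai.
    by case: i ai.
  suff : (n.+1 <= n)%N by rewrite ltnn.
  apply: nmin; apply/asboolP; exists (fun l => mu (lift i l)) => x.
  have [c cE] := muE x.
  exists (fun l => c (lift i l) - a (lift i l) / a i * c i).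
  move: a0; rewrite (bigD1_ord i) //= => /eqP; rewrite addr_eq0 => /eqP ci.
  have nz : iota (a i) != 0 by rewrite fmorph_eq0.
  have {}ci : mu i = - \sum_(l < n) iota (a (lift i l) / a i) * mu (lift i l).
    apply: (mulfI nz); rewrite ci mulrN; congr (- _).
    rewrite mulr_sumr; apply: eq_bigr => l _.
    by rewrite mulrA -rmorphM [a i * _]mulrCA divff ?mulr1.
  rewrite cE (bigD1_ord i) //= ci mulrN mulr_sumr addrC -sumrB.
  by apply: eq_bigr => l _; rewrite rmorphB !rmorphM; ring.
have /choice[c cE] := muE.
have cD i : point_derivation (fun a => c a i).
  have uniq (x y : 'I_n -> F) : \sum_i iota (x i) * mu i =
      \sum_i iota (y i) * mu i -> forall i, x i = y i.
    move=> xy l; apply/eqP; rewrite -subr_eq0; apply/eqP.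
    apply: (indep (fun i => x i - y i)).
    rewrite -[RHS](subrr (\sum_i iota (x i) * mu i)) [X in _ - X]xy -sumrB.
    by apply: eq_bigr => k _; rewrite rmorphB mulrBl.
  split=> [k x y | x y]; move: i; apply: uniq.
    rewrite -cE sD !cE -[_ *: _]/(_ * _) mulr_sumr -big_split /=.
    by apply: eq_bigr => i _; rewrite rmorphD rmorphM; ring.
  rewrite -cE DM !cE mulr_sumr mulr_suml -big_split /=.
  by apply: eq_bigr => i _; rewrite rmorphD !rmorphM; ring.
have cL i : (fun a => c a i : F^o) \in @derivations _ B by exact/asboolP.
exists (\sum_i mu i *: j (Lie (cL i))); apply: lie_eq.
have [le _] := lie_derivation (lie_ext (\sum_i mu i *: j (Lie (cL i)))).
apply: (@ext_ext _ _ _ _ K^o) => [||a]; [exact: le | exact: ld' |].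
have l0 := lie_fun_linear (G := ext_group iota B) (j a).
rewrite (linearm_sum lie_ext_linear) (linearm_sum l0) -[RHS]/(D a) cE.
apply: eq_bigr => i _.
by rewrite (linearmZ lie_ext_linear) (linearmZ l0) lie_ext_in mulrC.
Qed.

Definition lie_ext_inv (d' : lie (ext_group iota B)) : ext iota (lie B) :=
  projT1 (cid (lie_ext_surj d')).

Lemma lie_ext_invK : cancel lie_ext_inv lie_ext.
Proof. by move=> d'; rewrite /lie_ext_inv; case: cid. Qed.

Lemma lie_extK : cancel lie_ext lie_ext_inv.
Proof. by move=> t; apply: lie_ext_inj; rewrite lie_ext_invK. Qed.

Lemma lie_ext_inv_linear : linear lie_ext_inv.
Proof.
move=> c d d'; apply: lie_ext_inj.
by rewrite lie_ext_linear !lie_ext_invK.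
Qed.

Lemma lie_ext_bracket_in (d d' : lie B) :
  lie_bracket (lie_ext (j d)) (lie_ext (j d')) = lie_ext (j (lie_bracket d d')).
Proof.
apply: lie_eq.
have [l1 _] := lie_derivation (lie_bracket (lie_ext (j d)) (lie_ext (j d'))).
have [l2 _] := lie_derivation (lie_ext (j (lie_bracket d d'))).
apply: (@ext_ext _ _ _ _ K^o) => [||a]; [exact: l1 | exact: l2 |].
rewrite lie_ext_in /= rmorphB.
have conv (e e' : lie B) :
    convol (lie_fun (lie_ext (j e))) (lie_fun (lie_ext (j e'))) (j a) =
    iota (convol (lie_fun e) (lie_fun e') a).
  rewrite /convol /= ext_comul_in.
  have [le _] := lie_derivation e; have [le' _] := lie_derivation e'.
  have [Le _] := lie_derivation (lie_ext (j e)).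
  have [Le' _] := lie_derivation (lie_ext (j e')).
  apply: (@tlift_smap _ _ iota _ _ _ _ K^o F^o _ _ _ _ (fun x => iota x)
    _ (@sj _) (@sj _) _ (scalar_bilin Le Le') (scalar_bilin le le')).
    by move=> k x y; rewrite rmorphD rmorphM.
  by move=> u v; rewrite !lie_ext_in rmorphM.
by rewrite !conv.
Qed.

End LieExtension.

Section PairExtension.
Variables (F K : fieldType) (iota : {rmorphism F -> K}).
Notation j := (@inext F K iota _).

Let sj (V : lmodType F) : semilin iota (@inext F K iota V).
Proof. exact: inext_semilin. Qed.
Let st (U V : lmodType F) : semilin iota (@text F K iota U V).
Proof. exact: text_semilin. Qed.

Section Algebra.
Variable L : lieAlgebra F.

Let brK := ebil (iota := iota) (@bracket F L).
Let brK_bilin : bilin brK. Proof. exact: ebil_bilin (@bracket_bilin F L). Qed.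
Let brK_in x y : brK (j x) (j y) = j (bracket x y).
Proof. exact: ebil_in (@bracket_bilin F L). Qed.

Lemma bracketC (x y : L) : bracket x y = - bracket y x.
Proof.
have [bl br] := @bracket_bilin F L.
have := bracketxx (x + y); rewrite (linearmD (bl (x + y))) !(linearmD (br _)).
by rewrite !bracketxx add0r addr0 => /eqP; rewrite addr_eq0 => /eqP.
Qed.

Let brKC x y : brK x y = - brK y x.
Proof.
have [bl br] := brK_bilin.
have lN (V : lmodType K) : linear (fun v : V => - v).
  by move=> c u v; rewrite opprD scalerN.
move: x; apply: ext_ext => [||x].
- exact: bl.
- exact: linear_comp (lN _) (br y).
move: y; apply: ext_ext => [||y].
- exact: br.
- exact: linear_comp (lN _) (bl _).
by rewrite !brK_in bracketC -scaleN1r (semilinmZ _ _ (@sj _)) rmorphN1 scaleN1r.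
Qed.

Let brKxx x : brK x x = 0.
Proof.
have [bl br] := brK_bilin.
elim/ext_ind: x => [|x y hx hy|c x].
- exact: (linearm0 (br _)).
- rewrite (linearmD (bl (x + y))) !(linearmD (br _)) hx hy add0r addr0.
  by rewrite brKC addNr.
- rewrite (linearmZ (bl (c *: j x))) (linearmZ (br _)) brK_in bracketxx.
  by rewrite (semilinm0 (@sj _)) !scaler0.
Qed.

Let brK_jacobi x y z :
  brK x (brK y z) + brK y (brK z x) + brK z (brK x y) = 0.
Proof.
have [bl br] := brK_bilin.
have l0 (U V : lmodType K) : linear (fun _ : U => 0 : V).
  by move=> c u v; rewrite scaler0 addr0.
have lD (U V : lmodType K) (f g : U -> V) : linear f -> linear g ->
    linear (fun u => f u + g u).
  by move=> lf lg c u v; rewrite lf lg scalerDr addrACA.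
move: x; apply: ext_ext => [||x]; [|exact: l0|].
  apply: (lD); last exact: linear_comp (br z) (bl y).
  by apply: (lD); [exact: bl | exact: linear_comp (br y) (br z)].
move: y; apply: ext_ext => [||y]; [|exact: l0|].
  apply: (lD); last exact: linear_comp (br z) (br _).
  by apply: (lD); [exact: linear_comp (br _) (bl z) | exact: bl].
move: z; apply: ext_ext => [||z]; [|exact: l0|].
  apply: (lD); last exact: bl.
  by apply: (lD); [exact: linear_comp (br _) (br _)
                |exact: linear_comp (br _) (bl _)].
by rewrite !brK_in -!(semilinmD _ _ (@sj _)) jacobi (semilinm0 (@sj _)).
Qed.

Definition ext_lieAlgebra : lieAlgebra K :=
  @LieAlgebra K (ext iota L) brK brK_bilin brKxx brK_jacobi.

End Algebra.

Section DifferentialExtension.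
Variables (B : algGroup F) (V : lmodType F) (r : rep B V).

Lemma deriv_bilin (R : fieldType) (G : algGroup R) (W : lmodType R)
    (d : lie G) : bilin (fun (w : W) a => (lie_fun d a : R) *: w).
Proof.
have [ld _] := lie_derivation d.
split=> [v c x y | v c x y]; first by rewrite scalerDr !scalerA mulrC.
by rewrite ld scalerDl scalerA.
Qed.

Lemma differential_linear (R : fieldType) (G : algGroup R) (W : lmodType R)
    (r' : rep G W) (d : lie G) : linear (differential r' d).
Proof.
exact: linear_comp (tlift_linear (deriv_bilin W d)) (@coact_linear _ _ _ r').
Qed.

Lemma differential_linearl (R : fieldType) (G : algGroup R) (W : lmodType R)
    (r' : rep G W) (w : W) : linear (fun d => differential r' d w).
Proof.
move=> c d d'; rewrite /differential.
have b := @deriv_bilin R G W.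
elim/tens_ind: (coact r' w) => [|s t IHs IHt|u a].
- by rewrite !(linearm0 (tlift_linear (b _))) scaler0 addr0.
- by rewrite !(linearmD (tlift_linear (b _))) IHs IHt scalerDr addrACA.
- by rewrite !tlift_pure// lie_fun_linear scalerDl scalerA.
Qed.

Lemma ext_differential_in (d : lie B) (v : V) :
  differential (ext_rep iota r) (lie_ext (j d)) (j v) =
  j (differential r d v).
Proof.
rewrite /differential /= ext_coact_in.
apply: (tlift_smap _ (@sj _) (@sj _) (@sj _)
  (deriv_bilin (ext iota V) (lie_ext (j d))) (deriv_bilin V d)).
by move=> u a; rewrite lie_ext_in (semilinmZ _ _ (@sj _)).
Qed.

End DifferentialExtension.

(* Equivariance of a bilinear map is preserved by scalar extension. *)
Lemma ext_equivariant (B : algGroup F) (U V W : lmodType F) (r : rep B U)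
    (r' : rep B V) (r'' : rep B W) (f : U -> V -> W) : bilin f ->
  (forall u v, coact r'' (f u v) = tmap2 f *%R (coact r u) (coact r' v)) ->
  forall x y, coact (ext_rep iota r'') (ebil f x y) =
    tmap2 (ebil (iota := iota) f) *%R (coact (ext_rep iota r) x)
      (coact (ext_rep iota r') y).
Proof.
move=> bf fE x y.
have bm := mul_bilin (coord B).
have [el er] := ebil_bilin iota bf.
have [tl tr] := tmap2_bilin (ebil_bilin iota bf) (ebil_bilin iota bm).
have lr := @ext_coact_linear F K iota B _ r.
have lr' := @ext_coact_linear F K iota B _ r'.
have lr'' := @ext_coact_linear F K iota B _ r''.
move: x; apply: ext_ext => [||u].
- exact: linear_comp lr'' (el y).
- exact: linear_comp (tl _) lr.
move: y; apply: ext_ext => [||v].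
- exact: linear_comp lr'' (er _).
- exact: linear_comp (tr _) lr'.
by rewrite ebil_in//= !ext_coact_in fE text_tmap2.
Qed.

Variable P : pair_data F.
Notation L := (ext_lieAlgebra (algebra P)).
Notation G := (ext_group iota (group P)).

(* The extension of scalars of emb, along Lie(B_K) = K (x) Lie(B). *)
Definition ext_emb (d : lie G) : L := emap (@emb F P) (lie_ext_inv d).

Let semb := @emap_linear F K iota _ _ _ (@emb_linear F P).

Lemma ext_emb_linear : linear ext_emb.
Proof. exact: linear_comp semb (@lie_ext_inv_linear _ _ iota (group P)). Qed.

Lemma ext_emb_lie_ext t : ext_emb (lie_ext t) = emap (@emb F P) t.
Proof. by rewrite /ext_emb lie_extK. Qed.

Lemma ext_emb_inj : injective ext_emb.
Proof.
move=> d d' /(emap_inj (@emb_linear F P) (@emb_inj F P)) dd'.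
by rewrite -[d]lie_ext_invK dd' lie_ext_invK.
Qed.

Lemma lie_bracket_bilin (R : fieldType) (H : algGroup R) :
  bilin (@lie_bracket R H).
Proof.
have lie_conv (d : lie H) := (lie_derivation d).1.
have convD (c : R) (d d' e : lie H) t :
    tlift (fun x y => lie_fun (c *: d + d') x * lie_fun e y : R^o) t =
    c * tlift (fun x y => lie_fun d x * lie_fun e y : R^o) t +
    tlift (fun x y => lie_fun d' x * lie_fun e y : R^o) t.
  have b (d1 d2 : lie H) := scalar_bilin (lie_conv d1) (lie_conv d2).
  elim/tens_ind: t => [|s t IHs IHt|u a].
  - by rewrite !(linearm0 (tlift_linear (b _ _))) mulr0 addr0.
  - by rewrite !(linearmD (tlift_linear (b _ _))) IHs IHt; ring.
  - by rewrite !tlift_pure// lie_fun_linear -[_ *: _]/(c * _); ring.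
have convDr (c : R) (d d' e : lie H) t :
    tlift (fun x y => lie_fun e x * lie_fun (c *: d + d') y : R^o) t =
    c * tlift (fun x y => lie_fun e x * lie_fun d y : R^o) t +
    tlift (fun x y => lie_fun e x * lie_fun d' y : R^o) t.
  have b (d1 d2 : lie H) := scalar_bilin (lie_conv d1) (lie_conv d2).
  elim/tens_ind: t => [|s t IHs IHt|u a].
  - by rewrite !(linearm0 (tlift_linear (b _ _))) mulr0 addr0.
  - by rewrite !(linearmD (tlift_linear (b _ _))) IHs IHt; ring.
  - by rewrite !tlift_pure// lie_fun_linear -[_ *: _]/(c * _); ring.
split=> [e c d d' | e c d d']; apply: lie_eq => a; rewrite lie_fun_linear /=;
  rewrite /convol convD convDr -[_ *: _]/(c * _); ring.
Qed.

Lemma ext_emb_bracket d d' :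
  ext_emb (lie_bracket d d') = bracket (ext_emb d) (ext_emb d').
Proof.
rewrite -[d]lie_ext_invK -[d']lie_ext_invK.
move: (lie_ext_inv d) (lie_ext_inv d') => {d d'} s t.
have [ll lr] := @lie_bracket_bilin K G.
have [bl br] := @bracket_bilin K L.
have lx := @lie_ext_linear _ _ iota (group P).
have lle := linear_comp ext_emb_linear lx.
move: s; apply: ext_ext => [||d].
- exact: linear_comp ext_emb_linear (linear_comp (ll _) lx).
- exact: linear_comp (bl _) lle.
move: t; apply: ext_ext => [||d'].
- exact: linear_comp ext_emb_linear (linear_comp (lr _) lx).
- exact: linear_comp (br _) lle.
rewrite lie_ext_bracket_in !ext_emb_lie_ext !(emap_in iota _ (@emb_linear F P)).
by rewrite emb_bracket; apply/esym/ebil_in/bracket_bilin.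
Qed.

Definition ext_action : rep G L := ext_rep iota (action P).

Lemma ext_action_bracket x y : coact ext_action (bracket x y) =
  tmap2 (@bracket K L) *%R (coact ext_action x) (coact ext_action y).
Proof.
exact: ext_equivariant (@bracket_bilin F _) (@action_bracket F P) x y.
Qed.

Lemma ext_action_differential d x :
  differential ext_action d x = bracket (ext_emb d) x.
Proof.
rewrite -[d]lie_ext_invK; move: (lie_ext_inv d) => {d} t.
have [bl br] := @bracket_bilin K L.
have lx := @lie_ext_linear _ _ iota (group P).
move: t; apply: ext_ext => [||d].
- exact: linear_comp (@differential_linearl _ _ _ ext_action x) lx.
- exact: linear_comp (bl x) (linear_comp ext_emb_linear lx).
move: x; apply: ext_ext => [||x].
- exact: differential_linear.
- exact: br.
rewrite ext_differential_in action_differential ext_emb_lie_ext.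
by rewrite (emap_in iota _ (@emb_linear F P)); apply/esym/ebil_in/bracket_bilin.
Qed.

Definition ext_pair : pair_data K :=
  @PairData K G L ext_emb ext_emb_linear ext_emb_inj ext_emb_bracket
    ext_action ext_action_bracket ext_action_differential.

Section ModuleExtension.
Variable X : pair_module P.

Definition ext_mrep : rep G (ext iota (carrier X)) := ext_rep iota (mrep X).
Definition ext_mact : L -> ext iota (carrier X) -> ext iota (carrier X) :=
  ebil (@mact F P X).

Lemma ext_mact_bilin : bilin ext_mact.
Proof. exact: ebil_bilin (@mact_bilin F P X). Qed.

Lemma ext_mact_in x v : ext_mact (j x) (j v) = j (mact x v).
Proof. exact: ebil_in (@mact_bilin F P X). Qed.

Lemma ext_mact_bracket x y v : ext_mact (bracket x y) v =
  ext_mact x (ext_mact y v) - ext_mact y (ext_mact x v).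
Proof.
have [bl br] := @bracket_bilin K L.
have [ml mr] := ext_mact_bilin.
have lB (U V : lmodType K) (f g : U -> V) : linear f -> linear g ->
    linear (fun u => f u - g u).
  by move=> lf lg c u w; rewrite lf lg scalerBr opprD addrACA.
move: x; apply: ext_ext => [||x].
- exact: linear_comp (ml v) (bl y).
- exact: lB (ml _) (linear_comp (mr y) (ml v)).
move: y; apply: ext_ext => [||y].
- exact: linear_comp (ml v) (br _).
- exact: lB (linear_comp (mr _) (ml v)) (ml _).
move: v; apply: ext_ext => [||v].
- exact: mr.
- exact: lB (linear_comp (mr _) (mr _)) (linear_comp (mr _) (mr _)).
have -> : bracket (j x : L) (j y : L) = j (bracket x y).
  exact: ebil_in (@bracket_bilin F (algebra P)).
rewrite !ext_mact_in mact_bracket.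
exact: (linearmB (@sj _ : linear (@inext F K iota _ : _ -> restr iota _))).
Qed.

Lemma ext_mact_equivariant x v : coact ext_mrep (ext_mact x v) =
  tmap2 ext_mact *%R (coact ext_action x) (coact ext_mrep v).
Proof.
exact: ext_equivariant (@mact_bilin F P X) (@mact_equivariant F P X) x v.
Qed.

Lemma ext_mact_differential d v :
  ext_mact (ext_emb d) v = differential ext_mrep d v.
Proof.
rewrite -[d]lie_ext_invK; move: (lie_ext_inv d) => {d} t.
have [ml mr] := ext_mact_bilin.
have lx := @lie_ext_linear _ _ iota (group P).
move: t; apply: ext_ext => [||d].
- exact: linear_comp (ml v) (linear_comp ext_emb_linear lx).
- exact: linear_comp (@differential_linearl _ _ _ ext_mrep v) lx.
move: v; apply: ext_ext => [||v].
- exact: mr.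
- exact: differential_linear.
rewrite ext_differential_in -mact_differential ext_emb_lie_ext.
by rewrite (emap_in iota _ (@emb_linear F P)) ext_mact_in.
Qed.

Definition ext_module : pair_module ext_pair :=
  @PairModule K ext_pair (ext iota (carrier X)) ext_mrep
    (@ext_rep_locally_finite F K iota _ _ _ (@mrep_locally_finite F P X))
    ext_mact ext_mact_bilin ext_mact_bracket ext_mact_equivariant
    ext_mact_differential.

End ModuleExtension.
End PairExtension.

Section Geometry.
Variable F : fieldType.
Implicit Types B N : algGroup F.

(* A homomorphism of group schemes N -> B, given by its comorphism. *)
Record group_hom (N B : algGroup F) := GroupHom {
  comorph : {lrmorphism coord B -> coord N};
  comorph_comul : forall a,
    comul (comorph a) = tmap comorph comorph (comul a);
  comorph_counit : forall a, counit (comorph a) = counit a }.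

Definition closed_immersion N B (f : group_hom N B) : Prop :=
  forall b, exists a, comorph f a = b.

(* The product of two R-points of B. *)
Definition point_mul B (R : comAlgType F) (g h : coord B -> R)
    (a : coord B) : R :=
  tlift (fun b c => g b * h c) (comul a).

(* For all F-algebras R and all g in B(R), n in N(R), the R-point
   g f(n) g^-1 of B lies in the image of N(R). *)
Definition normal_subgroup N B (f : group_hom N B) : Prop :=
  forall (R : comAlgType F) (g : {lrmorphism coord B -> R})
         (n : {lrmorphism coord N -> R}),
    exists n' : {lrmorphism coord N -> R}, forall a,
      point_mul (point_mul g (fun b => n (comorph f b)))
        (fun b => g (antipode b)) a = n' (comorph f a).

Definition trivial_group B : Prop := forall a : coord B, a = (counit a)%:A.

Definition connected_group B : Prop :=
  forall e : coord B, e * e = e -> e = 0 \/ e = 1.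

Definition reduced_group B : Prop := forall a : coord B, a ^+ 2 = 0 -> a = 0.

(* Every nonzero representation has a nonzero fixed vector. *)
Definition unipotent_group B : Prop :=
  forall (V : vectType F) (r : rep B V), (exists v : V, v != 0) ->
    exists v : V, v != 0 /\ coact r v = tpure v 1.

(* The nonzero idempotents e such that the open and closed subscheme where
   e = 1 is a connected component. *)
Definition component_idempotent B (e : coord B) : Prop :=
  [/\ e * e = e, e != 0 &
      forall f : coord B, f * f = f -> f * e = f -> f = 0 \/ f = e].

End Geometry.

(* The unipotent radical of B over an algebraic closure of F is trivial; over
   an algebraically closed field, smooth means reduced. *)
Definition reductive (F : fieldType) (B : algGroup F) : Prop :=
  forall (K : closedFieldType) (iota : {rmorphism F -> K}),
    (forall x : K, algebraicOver iota x) ->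
  forall (N : algGroup K) (f : group_hom N (ext_group iota B)),
    closed_immersion f -> normal_subgroup f -> connected_group N ->
    reduced_group N -> unipotent_group N -> trivial_group N.

Definition geometrically_connected_components (F : fieldType)
    (B : algGroup F) : Prop :=
  forall e : coord B, component_idempotent e ->
  forall (K : fieldType) (iota : {rmorphism F -> K}),
    @component_idempotent K (ext_group iota B) (inext iota e).

Definition is_pair (F : fieldType) (P : pair_data F) : Prop :=
  reductive (group P) /\ geometrically_connected_components (group P).

(* Main.v *)
Require Import Defs.
From mathcomp Require Import all_boot all_algebra.
From mathcomp Require Import boolp classical_sets functions.

(** Let [A] be the coordinate ring of [B], let [K] be an extension of [F], and
    write [V_K] for the scalar extension of [V].

    Going down from [K] to [F] is the inclusion of [K (x) Hom_B(V, X)] in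
    [Hom(V_K, X_K)]: morphisms [V -> X] that are independent over [F] remain
    independent over [K] ([emap_lin_indep]), so that the dimension over [K]
    bounds the dimension over [F] ([finite_dim_hom_descent]).

    Going up has two ingredients.  For [U] finite-dimensional over [F], this
    inclusion is an equality: [Hom(U_K, X_K)] is spanned over [K] by
    [Hom_B(U, X)] ([hom_rep_ext_span]).  A representation [V] of [B_K] need not
    be defined over [F], but each of its vectors lies in the image of a morphism
    [U_K -> V] with [U] a finite-dimensional representation of [B]
    ([rep_cover]).  Indeed the coaction of [v] involves finitely many elements
    of [K (x) A], hence of [A], and these lie in a finite-dimensional left
    coideal [D] of [A]; for [U] take the dual of [D], and send a linear form
    [g] on [D_K] to [(id (x) g)(coact v)].  This is equivariant, and the counit
    of [A] is sent to [v].  When [v] runs through a basis of [V], a morphism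
    [V -> X_K] is determined by its composites with the resulting maps
    [U_K -> V], which range over finite-dimensional spaces
    ([finite_dim_hom_ext]).

    The linear algebra takes place in spaces of arbitrary dimension, presented
    by universal properties; independence in tensor products and scalar
    extensions is detected by the linear forms dual to a finite independent
    family ([dual_family]), which exist by Zorn's lemma. *)

Set Implicit Arguments.
Unset Strict Implicit.
Unset Printing Implicit Defensive.

Import GRing.Theory.
Local Open Scope classical_set_scope.
Local Open Scope ring_scope.

(** * Independent families and linear forms *)

Section LinearIndependence.
Variable F : fieldType.
Implicit Types V W : lmodType F.

Definition lin_indep V n (x : 'I_n -> V) : Prop :=
  forall a : 'I_n -> F, \sum_i a i *: x i = 0 -> forall i, a i = 0.

Definition lin_span V n (x : 'I_n -> V) : set V :=
  [set v | exists a : 'I_n -> F, v = \sum_i a i *: x i].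

Definition lin_closed V (S : set V) : Prop :=
  S 0 /\ forall a u v, S u -> S v -> S (a *: u + v).

Lemma lin_closed_sum V (S : set V) n (a : 'I_n -> F) (x : 'I_n -> V) :
  lin_closed S -> (forall i, S (x i)) -> S (\sum_i a i *: x i).
Proof.
move=> [S0 SL] Sx; elim/big_rec: _ => // i v _ Sv; exact: SL.
Qed.

Lemma lin_span_closed V n (x : 'I_n -> V) : lin_closed (lin_span x).
Proof.
split=> [|a _ _ [b ->] [c ->]].
  by exists (fun=> 0); rewrite big1// => i _; rewrite scale0r.
exists (fun i => a * b i + c i); rewrite scaler_sumr -big_split /=.
by apply: eq_bigr => i _; rewrite scalerA scalerDl.
Qed.

Lemma lin_span_gen V n (x : 'I_n -> V) i : lin_span x (x i).
Proof.
exists (fun k => (k == i)%:R); rewrite (bigD1 i)//= eqxx scale1r big1 ?addr0//.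
by move=> k /negbTE->; rewrite scale0r.
Qed.

Section Extension.
Variables (V : lmodType F) (D : set V) (g : V -> F).
Hypothesis D_closed : lin_closed D.
Hypothesis g_linear : forall a u v,
  D u -> D v -> g (a *: u + v) = a * g u + g v.

Let graph : set (V * F^o) := [set p : V * F^o | D p.1 /\ p.2 = g p.1].

(** The first clause says that [G] is empty or extends [g]: the union of the
    empty chain has to be allowed. *)
Let partial_map (G : set (V * F^o)) : Prop :=
  [/\ forall p, G p -> graph `<=` G,
      forall a p q, G p -> G q -> G (a *: p + q) &
      forall c, G (0, c) -> c = 0].

Let g0 : g 0 = 0.
Proof.
have [D0 _] := D_closed.
by have := g_linear (-1) D0 D0; rewrite scaler0 addr0 mulN1r addNr.
Qed.

Let graph0 : graph (0, 0).
Proof. by split; [exact: D_closed.1 | rewrite g0]. Qed.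

Let graph_partial : partial_map graph.
Proof.
have [D0 DL] := D_closed.
split=> [p _ q|a [u c] [v d] [/= Du ->] [/= Dv ->]|c [_ /= ->]] //.
by split=> /=; [exact: DL|rewrite g_linear].
Qed.

Let total_graph : exists G,
  [/\ graph `<=` G, partial_map G & forall v, exists c, G (v, c)].
Proof.
have [|G [PG Gmax]] := @Zorn_bigcup (V * F^o)%type [set G | partial_map G].
  move=> C CP Ctot; split=> [p [G CG Gp] q gq|a p q [G CG Gp] [H CH Hq]|c [G CG]].
  - by exists G => //; have [h _ _] := CP G CG; exact: (h p).
  - have [GH|HG] := Ctot G H CG CH.
      by exists H => //; have [_ h _] := CP H CH; apply: h => //; exact: GH.
    by exists G => //; have [_ h _] := CP G CG; apply: h => //; exact: HG.
  - by have [_ _ h] := CP G CG; exact: h.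
have [Gg GL G0] := PG.
have gG : graph `<=` G.
  have [[p /Gg//]|nG] := pselect (exists p, G p).
  exfalso; apply: (Gmax graph); last exact: graph_partial.
  split=> [p Gp|/(_ (0, 0) graph0) G00]; first by case: nG; exists p.
  by apply: nG; exists (0, 0).
exists G; split=> // v; apply: contrapT => nv.
(* [G] enlarged by the line of [(v, 0)] contradicts maximality. *)
pose H : set (V * F^o) :=
  [set p : V * F^o | exists t : F, G (p.1 - t *: v, p.2)].
apply: (Gmax H); last split=> [p _ q /gG Gq|a p q [t Gp] [s Gq]|c [t /=]].
- split=> [[u c] Gp|/(_ (v, 0)) h].
    by exists 0; rewrite scale0r subr0.
  by apply: nv; exists 0; apply: h; exists 1; rewrite /= scale1r subrr; exact: gG.
- by exists 0; rewrite scale0r subr0; case: q Gq.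
- exists (a * t + s); have := GL a _ _ Gp Gq; congr (G (_, _)) => /=.
  by rewrite scalerBr scalerDl scalerA opprD addrACA.
- rewrite sub0r => Gt; have [t0|t0] := eqVneq t 0.
    by move: Gt; rewrite t0 scale0r oppr0; exact: G0.
  exfalso; apply: nv; exists (- t^-1 *: c).
  have := GL (- t^-1) _ _ Gt (gG _ graph0); congr (G (_, _)) => /=.
    by rewrite addr0 scalerN scaleNr opprK scalerA mulVf// scale1r.
  by rewrite addr0.
Qed.

(** Zorn's lemma gives a maximal graph of a partial linear form extending [g];
    it is total, because a form can be extended by 0 to one more vector. *)
Lemma extend_linear_form : exists phi : V -> F,
  scalar phi /\ forall v, D v -> phi v = g v.
Proof.
have [G [gG [_ GL G0] Gtot]] := total_graph.
have uniq v c d : G (v, c) -> G (v, d) -> c = d.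
  move=> Gc Gd; apply/eqP; rewrite -subr_eq0 addrC; apply/eqP; apply: G0.
  have := GL (-1) _ _ Gd Gc; congr (G (_, _)) => /=.
    by rewrite scaleN1r addNr.
  by rewrite scaleN1r.
have [phi phiG] := choice Gtot.
exists phi; split=> [a u v|v Dv]; last by apply: (uniq v) => //; exact: gG.
apply: (uniq (a *: u + v)); first exact: phiG.
exact: (GL _ _ _ (phiG u) (phiG v)).
Qed.

End Extension.

Lemma lin_indep_eq V n (x : 'I_n -> V) (a b : 'I_n -> F) : lin_indep x ->
  \sum_i a i *: x i = \sum_i b i *: x i -> a =1 b.
Proof.
move=> xI ab i; apply/eqP; rewrite -subr_eq0; apply/eqP.
apply: (xI (fun i => a i - b i)).
rewrite -[RHS](subrr (\sum_i a i *: x i)) [X in _ - X]ab -sumrB.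
by apply: eq_bigr => k _; rewrite scalerBl.
Qed.

(** The coordinate forms on the span of the [x i], extended to [V]: a finite
    independent family can be handled as if it were part of a basis. *)
Lemma dual_family V n (x : 'I_n -> V) (c : 'I_n -> F) : lin_indep x ->
  exists phi : V -> F, scalar phi /\ forall i, phi (x i) = c i.
Proof.
move=> xI.
have [coef coefE] : exists coef : V -> 'I_n -> F,
    forall v, lin_span x v -> v = \sum_i coef v i *: x i.
  have [|coef coefE] := @choice V ('I_n -> F)
      (fun v a => lin_span x v -> v = \sum_i a i *: x i); last by exists coef.
  move=> v; have [[a va]|nv] := pselect (lin_span x v); first by exists a.
  by exists (fun=> 0) => /nv.
have coef_eq a : coef (\sum_i a i *: x i) =1 a.
  by apply: (lin_indep_eq xI); rewrite -coefE//; exists a.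
have [|phi [lphi phiE]] := @extend_linear_form V (lin_span x)
    (fun v => \sum_i coef v i * c i) (lin_span_closed x).
  move=> a u v Su Sv; rewrite mulr_sumr -big_split /=.
  apply: eq_bigr => i _.
  rewrite mulrA -mulrDl; congr (_ * _).
  rewrite {1}(coefE u Su) {1}(coefE v Sv) scaler_sumr -big_split /=.
  rewrite (eq_bigr (fun k => (a * coef u k + coef v k) *: x k)) ?coef_eq//.
  by move=> k _; rewrite scalerA scalerDl.
exists phi; split=> // i; rewrite phiE; last exact: lin_span_gen.
rewrite (bigD1 i)//= big1 => [|k ki].
  have := @coef_eq (fun k => (k == i)%:R) i.
  rewrite (bigD1 i)//= eqxx scale1r big1 => [|k /negbTE->]; last exact: scale0r.
  by rewrite addr0 => ->; rewrite mul1r addr0.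
have := @coef_eq (fun k => (k == i)%:R) k.
rewrite (bigD1 i)//= eqxx scale1r big1 => [|l /negbTE->]; last exact: scale0r.
by rewrite addr0 => ->; rewrite (negbTE ki) mul0r.
Qed.

Lemma linear_forms_separate V (v : V) :
  (forall phi : V -> F, scalar phi -> phi v = 0) -> v = 0.
Proof.
move=> v0; apply/eqP; apply: contraT => nv.
have vI : lin_indep (fun _ : 'I_1 => v).
  move=> a; rewrite big_ord_recl big_ord0 addr0 => /eqP.
  by rewrite scaler_eq0 (negbTE nv) orbF => /eqP a0 i; rewrite [i]ord1.
have [phi [lphi phi1]] := dual_family (fun=> 1) vI.
by have := phi1 ord0; rewrite v0// => /esym/eqP; rewrite oner_eq0.
Qed.

(** Steinitz: the coordinates of the [x i] form an [n] by [N] matrix whose row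
    kernel is nonzero as soon as [N < n]. *)
Lemma lin_indep_size V n N (x : 'I_n -> V) (g : 'I_N -> V) :
  lin_indep x -> (forall i, lin_span g (x i)) -> (n <= N)%N.
Proof.
move=> xI /choice[a aE]; rewrite leqNgt; apply/negP => Nn.
pose M := \matrix_(i < n, k < N) a i k.
have : kermx M != 0.
  by rewrite -mxrank_eq0 mxrank_ker subn_eq0 -ltnNge (leq_ltn_trans (rank_leq_col _)).
case/eqP; apply/row_matrixP => r; rewrite row0; apply/rowP => i.
rewrite [LHS]mxE [RHS]mxE.
apply: (xI (fun i => kermx M r i)) i.
under eq_bigr do rewrite aE scaler_sumr.
rewrite exchange_big /= big1// => k _.
under eq_bigr do rewrite scalerA.
rewrite -scaler_suml.
have /matrixP/(_ r k) := mulmx_ker M; rewrite [LHS]mxE [RHS]mxE => E.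
have -> : \sum_i kermx M r i * a i k = 0; last exact: scale0r.
by rewrite -[RHS]E; apply: eq_bigr => l _; rewrite [M _ _]mxE.
Qed.

(** An independent family of maximal size in [S] spans [S]. *)
Lemma finite_dim_bounded V (S : set V) N : lin_closed S ->
  (forall n (x : 'I_n -> V),
     (forall i, S (x i)) -> lin_indep x -> (n <= N)%N) ->
  finite_dim S.
Proof.
move=> SC Sbound.
pose Q n := `[< exists x : 'I_n -> V, (forall i, S (x i)) /\ lin_indep x >].
have Q0 : exists n, Q n.
  by exists 0%N; apply/asboolP; exists (fun=> 0); split=> [|a _] [].
have QN n : Q n -> (n <= N)%N by move=> /asboolP[x [Sx]]; exact: Sbound.
case: (ex_maxnP Q0 QN) => n /asboolP[x [Sx xI]] nmax.
exists n, x; split=> // w Sw; apply: contrapT => nw.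
suff : (n.+1 <= n)%N by rewrite ltnn.
(* Otherwise [w] can be added to the family. *)
apply: nmax; apply/asboolP.
exists (fun i : 'I_n.+1 => oapp x w (unlift ord0 i)); split=> [i|a].
  by case: unliftP => [k _|_] //=; exact: Sx.
rewrite big_ord_recl unlift_none /=.
under eq_bigr do rewrite liftK /=.
move=> E; have a0 : a ord0 = 0.
  apply/eqP; apply: contraT => na; exfalso; apply: nw.
  exists (fun i => - (a ord0)^-1 * a (lift ord0 i)).
  move: E => /eqP; rewrite addr_eq0 => /eqP/(congr1 (fun v => (a ord0)^-1 *: v)).
  rewrite scalerA mulVf// scale1r scalerN scaler_sumr => ->.
  rewrite -sumrN; apply: eq_bigr => i _.
  by rewrite scalerA mulNr scaleNr.
move: E; rewrite a0 scale0r add0r => E i.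
by case: (unliftP ord0 i) => [k|] -> //; exact: (xI (fun k => a (lift ord0 k))).
Qed.

Lemma finite_dim_sub V (S : set V) N (g : 'I_N -> V) : lin_closed S ->
  S `<=` lin_span g -> finite_dim S.
Proof.
move=> SC Sg; apply: (finite_dim_bounded (N := N)) => // n x Sx xI.
by apply: (lin_indep_size xI) => i; exact: Sg.
Qed.

End LinearIndependence.
(** * Independence under extension of scalars *)

Section ScalarExtension.
Variables (F K : fieldType) (iota : {rmorphism F -> K}).
Notation j := (@inext F K iota _).

Let sj (V : lmodType F) : semilin iota (@inext F K iota V).
Proof. exact: inext_semilin. Qed.

Definition indep_over n (c : 'I_n -> K) : Prop :=
  forall a : 'I_n -> F, \sum_i iota (a i) * c i = 0 -> forall i, a i = 0.

Lemma linear_form_semilin (V : lmodType F) (phi : V -> F) : scalar phi ->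
  semilin iota (fun v => iota (phi v) : K^o).
Proof. by move=> lphi a u v; rewrite lphi rmorphD rmorphM. Qed.

Lemma inext_sum (V : lmodType F) n (a : 'I_n -> F) (x : 'I_n -> V) :
  j (\sum_i a i *: x i) = \sum_i iota (a i) *: j (x i).
Proof.
rewrite (@linearm_sum _ _ (restr iota _) _ (@sj V)).
by apply: eq_bigr => i _; rewrite (semilinmZ _ _ (@sj _)).
Qed.

(** The forms dual to [x] extend to [K (x) V], where they are dual to the
    [j (x i)]. *)
Lemma inext_lin_indep (V : lmodType F) n (x : 'I_n -> V) :
  lin_indep x -> lin_indep (fun i => j (x i)).
Proof.
move=> xI a ax i.
have [phi [lphi phiE]] := dual_family (fun k => (k == i)%:R) xI.
have sphi := linear_form_semilin lphi.
have := congr1 (elift (fun v => iota (phi v) : K^o)) ax.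
rewrite (linearm0 (elift_linear sphi)) (linearm_sum (elift_linear sphi)).
move=> E; rewrite -[RHS]E (bigD1 i)//= big1 => [|k ki];
  rewrite (linearmZ (elift_linear sphi)) elift_in// phiE.
  by rewrite eqxx rmorph1 addr0; exact/esym/mulr1.
by rewrite (negbTE ki) rmorph0 scaler0.
Qed.

(** A linear form on [V] turns the relation into one between the [c i] with
    coefficients in [F], and linear forms separate points. *)
Lemma ext_coef_indep (V : lmodType F) n (c : 'I_n -> K) (y : 'I_n -> V) :
  indep_over c -> \sum_i c i *: j (y i) = 0 -> forall i, y i = 0.
Proof.
move=> cI y0 i; apply: linear_forms_separate => phi lphi.
apply: (cI (fun i => phi (y i))).
have sphi := linear_form_semilin lphi.
have := congr1 (elift (fun v => iota (phi v) : K^o)) y0.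
rewrite (linearm0 (elift_linear sphi)) (linearm_sum (elift_linear sphi)).
move=> E; rewrite -[RHS]E; apply: eq_bigr => k _.
by rewrite (linearmZ (elift_linear sphi)) elift_in// mulrC.
Qed.

Lemma eval_linear (T : Type) (V : lmodType F) (t : T) :
  linear (fun f : T -> V => f t).
Proof. by []. Qed.

(** Injectivity of the canonical map from [K (x) Map(T, V)] to
    [Map(T, K (x) V)]: written with [F]-independent coefficients, an element is
    killed by all evaluations only if each of its terms is. *)
Lemma ext_fun_eq0 (T : Type) (V : lmodType F) (s : ext iota (T -> V)) :
  (forall t, emap (fun f : T -> V => f t) s = 0) -> s = 0.
Proof.
have [n [c [f [-> cI]]]] := ext_indep s => s0.
rewrite big1// => i _.
suff -> : f i = 0 by rewrite (semilinm0 (@sj _)) scaler0.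
apply/funext => t; apply: (ext_coef_indep cI (y := fun i => f i t)).
have le := @emap_linear F K iota _ _ _ (@eval_linear T V t).
rewrite -[RHS](s0 t) (linearm_sum le); apply: eq_bigr => k _.
by rewrite (linearmZ le) (emap_in iota _ (@eval_linear T V t)).
Qed.

(** A finite family in [K (x) V] is one element of [K (x) Map('I_n, V)], hence
    its members can be written with the same independent coefficients. *)
Lemma ext_family (V : lmodType F) n (t : 'I_n -> ext iota V) :
  exists N (c : 'I_N -> K) (x : 'I_n -> 'I_N -> V),
    indep_over c /\ forall i, t i = \sum_s c s *: j (x i s).
Proof.
pose inj (i : 'I_n) (v : V) : 'I_n -> V := fun k => if k == i then v else 0.
have linj i : linear (inj i).
  move=> a u v; apply/funext => k; rewrite /inj.
  transitivity (a *: inj i u k + inj i v k) => //; rewrite /inj.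
  by case: eqP; rewrite ?scaler0 ?addr0.
have [N [c [f [tE cI]]]] := ext_indep (\sum_i emap (inj i) (t i)).
exists N, c, (fun i s => f s i); split=> // i.
have lev k := @emap_linear F K iota _ _ _ (@eval_linear 'I_n V k).
have injK k (u : ext iota V) : emap (fun g : 'I_n -> V => g k) (emap (inj k) u) = u.
  move: u; apply: ext_ext => [||v].
  - exact: linear_comp (lev k) (@emap_linear F K iota _ _ _ (linj k)).
  - exact: linear_idm.
  by rewrite (emap_in iota _ (linj k)) (emap_in iota _ (@eval_linear _ _ k)) /inj eqxx.
have inj0 k l (u : ext iota V) : k != l ->
    emap (fun g : 'I_n -> V => g k) (emap (inj l) u) = 0.
  move=> /negbTE kl; move: u; apply: (ext_ext (g := fun=> 0)) => [||v].
  - exact: linear_comp (lev k) (@emap_linear F K iota _ _ _ (linj l)).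
  - by move=> a u v; rewrite scaler0 addr0.
  rewrite (emap_in iota _ (linj l)) (emap_in iota _ (@eval_linear _ _ k)) /inj kl.
  exact: (semilinm0 (@sj _)).
have := congr1 (emap (fun g : 'I_n -> V => g i)) tE.
rewrite !(linearm_sum (lev i)) (bigD1 i)//= injK big1 => [|l li]; last first.
  by rewrite inj0// eq_sym.
rewrite addr0 => ->; apply: eq_bigr => s _.
by rewrite (linearmZ (lev i)) (emap_in iota _ (@eval_linear _ _ i)).
Qed.

(** The isomorphism between a tensor product over [K] of scalar extensions and
    the scalar extension of the tensor product over [F]. *)
Definition text_inv (U V : lmodType F) :
    tens (ext iota U) (ext iota V) -> ext iota (tens U V) :=
  tlift (ebil (@tpure F U V)).

Lemma text_inv_linear (U V : lmodType F) : linear (@text_inv U V).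
Proof. exact: tlift_linear (ebil_bilin iota (tpure_bilin U V)). Qed.

Lemma textK (U V : lmodType F) (t : tens U V) : text_inv (text iota t) = j t.
Proof.
have b := ebil_bilin iota (tpure_bilin U V).
move: t; apply: tens_sext => [||u v].
- exact: semilin_post (@text_inv_linear U V) (@text_semilin _ _ iota U V).
- exact: sj.
by rewrite text_pure /text_inv tlift_pure// ebil_in//; exact: tpure_bilin.
Qed.

End ScalarExtension.
(** * Morphisms of representations under extension of scalars *)

Section HomSpaces.
Variable F : fieldType.

Lemma tmap_linear_left (U V U' : lmodType F) (a : F) (f g : U -> U')
    (t : tens U V) : linear f -> linear g ->
  tmap (a *: f + g) id t = a *: tmap f id t + tmap g id t.
Proof.
move=> lf lg; have lid := @linear_idm F V.
have lfg : linear (a *: f + g).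
  move=> c u v; rewrite -![(a *: f + g) _]/(a *: f _ + g _) lf lg.
  by rewrite !scalerDr addrACA !scalerA mulrC.
elim/tens_ind: t => [|s t IHs IHt|u v].
- by rewrite !(linearm0 (tmap_linear _ _))// scaler0 addr0.
- by rewrite !(linearmD (tmap_linear _ _))// IHs IHt scalerDr addrACA.
- rewrite !tmap_pure// -[(a *: f + g) u]/(a *: f u + g u).
  exact: (tpure_bilin _ _).1.
Qed.

Lemma tmap0_left (U V U' : lmodType F) (t : tens U V) :
  tmap (0 : U -> U') id t = 0.
Proof.
have lid := @linear_idm F V.
have l0 : linear (0 : U -> U') by move=> c u v; rewrite scaler0 addr0.
elim/tens_ind: t => [|s t IHs IHt|u v].
- exact: (linearm0 (tmap_linear _ _)).
- by rewrite (linearmD (tmap_linear _ _))// IHs IHt addr0.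
- by rewrite tmap_pure//; exact: (linearm0 ((tpure_bilin _ _).1 _)).
Qed.

Lemma hom_rep_closed (B : algGroup F) (V W : lmodType F) (r : rep B V)
    (r' : rep B W) : lin_closed (hom_rep r r').
Proof.
split; first split.
- by move=> c u v; rewrite scaler0 addr0.
- by move=> v; rewrite tmap0_left; exact: (linearm0 (@coact_linear _ _ _ r')).
move=> a f g [lf fE] [lg gE]; split.
  move=> c u v; rewrite -![(a *: f + g) _]/(a *: f _ + g _) lf lg.
  by rewrite !scalerDr addrACA !scalerA mulrC.
move=> v; rewrite tmap_linear_left// -fE -gE.
by rewrite -[(a *: f + g) v]/(a *: f v + g v) coact_linear.
Qed.

Lemma hom_rep_comp (B : algGroup F) (U V W : lmodType F) (r : rep B U)
    (r' : rep B V) (r'' : rep B W) f g :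
  hom_rep r' r'' f -> hom_rep r r' g -> hom_rep r r'' (fun u => f (g u)).
Proof.
move=> [lf fE] [lg gE]; split=> [|u]; first exact: linear_comp.
rewrite fE gE; have lid W' := @linear_idm F W'.
have lfg := linear_comp lf lg.
move: (coact r u); apply: tens_ext.
- exact: linear_comp (tmap_linear _ _) (tmap_linear _ _).
- exact: tmap_linear.
- by move=> x a; rewrite !tmap_pure.
Qed.

Lemma sum_fctE (T : Type) (V : lmodType F) n (a : 'I_n -> F)
    (f : 'I_n -> T -> V) t : (\sum_i a i *: f i) t = \sum_i a i *: f i t.
Proof. by rewrite fct_sumE. Qed.

End HomSpaces.

Section HomExtension.
Variables (F K : fieldType) (iota : {rmorphism F -> K}) (B : algGroup F).
Notation j := (@inext F K iota _).

Let sj (V : lmodType F) : semilin iota (@inext F K iota V).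
Proof. exact: inext_semilin. Qed.

Lemma hom_rep_ext (V W : lmodType F) (r : rep B V) (r' : rep B W) f :
  hom_rep r r' f -> hom_rep (ext_rep iota r) (ext_rep iota r') (emap f).
Proof.
move=> [lf fE]; have lef := @emap_linear F K iota _ _ _ lf; split=> //.
have lid (V' : lmodType K) := @linear_idm K V'.
have lidF (V' : lmodType F) := @linear_idm F V'.
apply: ext_ext => [||v].
- exact: linear_comp (@coact_linear _ _ _ (ext_rep iota r')) lef.
- exact: linear_comp (tmap_linear lef (lid _))
    (@coact_linear _ _ _ (ext_rep iota r)).
rewrite (emap_in iota _ lf) /= !ext_coact_in fE /text.
rewrite (tmap_smap _ (@sj _) (@sj _) lef (lid _)).
rewrite (smap_tmap _ (@sj _) (@sj _) lf (lidF _)).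
by apply: (congr1 (fun s => s (coact r v))); apply: eq_smap => // u;
  rewrite (emap_in iota _ lf).
Qed.

Lemma emap_lin_indep (V W : lmodType F) n (f : 'I_n -> V -> W) :
  (forall i, linear (f i)) -> lin_indep f ->
  lin_indep (fun i => emap (iota := iota) (f i)).
Proof.
move=> lf fI a fa; apply: (inext_lin_indep (iota := iota) fI).
apply: ext_fun_eq0 => v.
have lev := @emap_linear F K iota _ _ _ (@eval_linear F V W v).
rewrite (linearm_sum lev) -[RHS]/((0 : ext iota V -> ext iota W) (j v)) -fa.
rewrite sum_fctE; apply: eq_bigr => i _.
by rewrite (linearmZ lev) (emap_in iota _ (@eval_linear F V W v)) emap_in.
Qed.

(** An independent family of morphisms stays independent over [K], so the
    dimension over [K] bounds the dimension over [F]. *)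
Lemma finite_dim_hom_descent (V W : lmodType F) (r : rep B V) (r' : rep B W) :
  finite_dim (hom_rep (ext_rep iota r) (ext_rep iota r')) ->
  finite_dim (hom_rep r r').
Proof.
move=> [N [e [_ span_e]]].
apply: (finite_dim_bounded (N := N)); first exact: hom_rep_closed.
move=> n f fS fI.
apply: (lin_indep_size (g := e) (emap_lin_indep (fun i => (fS i).1) fI)).
by move=> i; apply: span_e; exact: hom_rep_ext.
Qed.

(** Write [h] on a basis of [V] with [F]-independent coefficients [c s] common
    to all basis vectors, so that [h (j u)] is the sum of the
    [c s *: j (f s u)].  As the [c s] are independent, equivariance of [h]
    forces that of every [f s]. *)
Lemma hom_rep_ext_span (V : vectType F) (W : lmodType F) (r : rep B V)
    (r' : rep B W) N (e : 'I_N -> V -> W) :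
  (forall k, hom_rep r r' (e k)) -> hom_rep r r' `<=` lin_span e ->
  hom_rep (ext_rep iota r) (ext_rep iota r') `<=`
    lin_span (fun k => emap (iota := iota) (e k)).
Proof.
move=> eS span_e h [lh hE].
pose b := vbasis (fullv : {vspace V}).
have [M [c [x [cI hb]]]] :=
  ext_family (fun i : 'I_(\dim (fullv : {vspace V})) => h (j b`_i)).
pose f s u := \sum_i coord b i u *: x i s.
have lf s : linear (f s).
  move=> a u v; rewrite /f scaler_sumr -big_split /=; apply: eq_bigr => i _.
  by rewrite linearP scalerDl scalerA.
have sh : semilin iota (fun u => h (j u)) by exact: semilin_post.
have hf u : h (j u) = \sum_s c s *: j (f s u).
  rewrite {1}(coord_vbasis (memvf u)) inext_sum (linearm_sum lh).
  under eq_bigr do rewrite (linearmZ lh) hb scaler_sumr.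
  rewrite exchange_big /=; apply: eq_bigr => s _.
  rewrite inext_sum scaler_sumr; apply: eq_bigr => i _.
  by rewrite !scalerA mulrC.
have lid (V' : lmodType K) := @linear_idm K V'.
have lidF (V' : lmodType F) := @linear_idm F V'.
have st (U' V' : lmodType F) := @text_semilin F K iota U' V'.
have tE (t : tens V (Defs.coord B)) :
    tmap h id (text iota t) = \sum_s c s *: text iota (tmap (f s) id t).
  move: t; apply: tens_sext.
  - exact: semilin_post (tmap_linear lh (lid _)) (st _ _).
  - move=> a s t; rewrite scaler_sumr -big_split /=; apply: eq_bigr => k _.
    rewrite (tmap_linear (lf k) (lidF _)) st scalerDr !scalerA.
    by rewrite mulrC.
  - move=> u a; rewrite text_pure tmap_pure// hf.
    rewrite (linearm_sum ((tpure_bilin _ _).1 _)); apply: eq_bigr => s _.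
    by rewrite (linearmZ ((tpure_bilin _ _).1 _)) tmap_pure// text_pure.
have fS s : hom_rep r r' (f s).
  split=> // u; apply/eqP; rewrite -subr_eq0; apply/eqP; move: s.
  apply: (ext_coef_indep cI).
  have := hE (j u); rewrite /= ext_coact_in tE hf.
  rewrite (linearm_sum (@ext_coact_linear _ _ iota _ _ r')) => /eqP.
  rewrite -subr_eq0 -sumrB => /eqP/(congr1 (@text_inv _ _ iota _ _)).
  have ltx := @text_inv_linear F K iota W (Defs.coord B).
  rewrite (linearm0 ltx) (linearm_sum ltx) => E; rewrite -[RHS]E.
  apply: eq_bigr => s _.
  rewrite (linearmB ltx) !(linearmZ ltx).
  rewrite (linearmZ (@ext_coact_linear _ _ iota _ _ r')) ext_coact_in.
  rewrite (linearmZ ltx) !textK -scalerBr; congr (_ *: _).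
  exact: (linearmB (@sj _ : linear (j : _ -> restr iota _))).
have /choice[a aE] : forall s, exists a : 'I_N -> F, f s = \sum_k a k *: e k.
  by move=> s; exact: span_e.
exists (fun k => \sum_s c s * iota (a s k)).
apply/funext => y; rewrite sum_fctE; move: y.
have le k := @emap_linear F K iota _ _ _ (eS k).1.
apply: ext_ext => // [a' y z|u].
  rewrite scaler_sumr -big_split /=; apply: eq_bigr => k _.
  by rewrite le scalerDr !scalerA mulrC.
rewrite hf; under [RHS]eq_bigr do rewrite scaler_suml.
rewrite exchange_big /=; apply: eq_bigr => s _.
rewrite aE sum_fctE inext_sum scaler_sumr; apply: eq_bigr => k _.
by rewrite scalerA (emap_in iota _ (eS k).1).
Qed.

End HomExtension.
(** * Finite families and tensors *)

Section Families.
Variable F : fieldType.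

(** A subfamily of minimal size with the same span is independent, as a member
    that is a combination of the others could be dropped. *)
Lemma lin_indep_subfamily (V : lmodType F) n (x : 'I_n -> V) :
  exists m (s : 'I_m -> 'I_n), lin_indep (fun l => x (s l)) /\
    forall i, lin_span (fun l => x (s l)) (x i).
Proof.
pose Q m := `[< exists s : 'I_m -> 'I_n,
  forall i, lin_span (fun l => x (s l)) (x i) >].
have exQ : exists m, Q m.
  by exists n; apply/asboolP; exists id => i; exact: lin_span_gen.
case: (ex_minnP exQ) => m /asboolP[s xs] mmin; exists m, s; split=> // a a0 i.
apply/eqP; apply: contraT => ai.
case: m s xs mmin a a0 i ai => [|m] s xs mmin a a0 i ai; first by case: i ai.
suff : (m.+1 <= m)%N by rewrite ltnn.
apply: mmin; apply/asboolP; exists (fun l => s (lift i l)) => k.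
have [c ->] := xs k; apply: lin_closed_sum; first exact: lin_span_closed.
move=> l; case: (unliftP i l) => [l'|] ->.
  exact: (lin_span_gen (fun l => x (s (lift i l)))).
move: a0; rewrite (bigD1_ord i)//= => /eqP; rewrite addr_eq0.
move=> /eqP/(congr1 (fun v => (a i)^-1 *: v)); rewrite scalerA mulVf// scale1r => ->.
exists (fun l => - ((a i)^-1 * a (lift i l))); rewrite scalerN scaler_sumr -sumrN.
by apply: eq_bigr => k' _; rewrite scalerA scaleNr.
Qed.

Lemma family_union (V : Type) n (N : 'I_n -> nat)
    (g : forall i, 'I_(N i) -> V) :
  exists M (f : 'I_M -> V), (forall i k, exists q, f q = g i k) /\
    forall q, exists i k, f q = g i k.
Proof.
pose T := {i : 'I_n & 'I_(N i)}.
exists #|{: T}|, (fun q => g (tag (enum_val q)) (tagged (enum_val q))); split.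
  move=> i k; exists (enum_rank (Tagged (fun i => 'I_(N i)) k)).
  by rewrite enum_rankK.
by move=> q; exists (tag (enum_val q)), (tagged (enum_val q)).
Qed.

Lemma tpure_suml (U V : lmodType F) n (a : 'I_n -> F) (u : 'I_n -> U) (v : V) :
  tpure (\sum_i a i *: u i) v = \sum_i a i *: tpure (u i) v.
Proof.
rewrite (linearm_sum ((tpure_bilin _ _).1 v)); apply: eq_bigr => i _.
by rewrite (linearmZ ((tpure_bilin _ _).1 v)).
Qed.

Lemma tpure_sumr (U V : lmodType F) n (a : 'I_n -> F) (u : U) (v : 'I_n -> V) :
  tpure u (\sum_i a i *: v i) = \sum_i a i *: tpure u (v i).
Proof.
rewrite (linearm_sum ((tpure_bilin _ _).2 u)); apply: eq_bigr => i _.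
by rewrite (linearmZ ((tpure_bilin _ _).2 u)).
Qed.

Definition tens_span (U V : lmodType F) n (y : 'I_n -> V) (t : tens U V) :
    Prop :=
  exists x : 'I_n -> U, t = \sum_i tpure (x i) (y i).

Lemma tens_span_sub (U V : lmodType F) n m (y : 'I_n -> V) (z : 'I_m -> V)
    (t : tens U V) :
  (forall i, lin_span z (y i)) -> tens_span y t -> tens_span z t.
Proof.
move=> /choice[a aE] [x ->]; exists (fun l => \sum_i a i l *: x i).
under eq_bigr do rewrite aE tpure_sumr.
rewrite exchange_big /=; apply: eq_bigr => l _.
by rewrite tpure_suml.
Qed.

Lemma tens_spanned (U V : lmodType F) (t : tens U V) :
  exists n (y : 'I_n -> V), tens_span y t.
Proof.
elim/tens_ind: t => [|s t [n [y [x ->]]] [m [y' [x' ->]]]|u v].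
- by exists 0%N, (fun=> 0), (fun=> 0); rewrite big_ord0.
- exists (n + m)%N.
  exists (fun i => match fintype.split i with inl i => y i | inr i => y' i end).
  exists (fun i => match fintype.split i with inl i => x i | inr i => x' i end).
  rewrite big_split_ord /=; congr (_ + _); apply: eq_bigr => i _.
    by rewrite (unsplitK (inl i)).
  by rewrite (unsplitK (inr i)).
- by exists 1%N, (fun=> v), (fun=> u); rewrite big_ord_recl big_ord0 addr0.
Qed.

Lemma tens_indep (U V : lmodType F) (t : tens U V) :
  exists n (x : 'I_n -> U) (y : 'I_n -> V),
    lin_indep x /\ t = \sum_i tpure (x i) (y i).
Proof.
have [n [y [x ->]]] := tens_spanned t.
have [m [s [xI /choice[a aE]]]] := lin_indep_subfamily x.
exists m, (fun l => x (s l)), (fun l => \sum_i a i l *: y i); split=> //.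
under eq_bigr do rewrite aE tpure_suml.
rewrite exchange_big /=; apply: eq_bigr => l _.
by rewrite tpure_sumr.
Qed.

Lemma form_bilin (U V : lmodType F) (phi : U -> F) :
  scalar phi -> bilin (fun (u : U) (v : V) => phi u *: v).
Proof.
move=> lphi; split=> [v a x y|u a x y].
  by rewrite lphi scalerDl scalerA.
by rewrite scalerDr !scalerA mulrC.
Qed.

Definition contract (U V : lmodType F) (phi : U -> F) : tens U V -> V :=
  tlift (fun u v => phi u *: v).

Lemma contract_linear (U V : lmodType F) (phi : U -> F) : scalar phi ->
  linear (@contract U V phi).
Proof. by move=> lphi; exact: tlift_linear (form_bilin V lphi). Qed.

Lemma contract_pure (U V : lmodType F) (phi : U -> F) u v : scalar phi ->
  contract phi (tpure u v) = phi u *: v :> V.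
Proof. by move=> lphi; exact: tlift_pure (form_bilin V lphi). Qed.

Lemma contract_tassoc (U V W : lmodType F) (phi : U -> F) u (t : tens V W) :
  scalar phi ->
  tmap (contract phi) id (tassoc (tpure u t)) = phi u *: t.
Proof.
move=> lphi; have lc := @contract_linear _ V _ lphi.
have lid := @linear_idm F W.
move: t; apply: tens_ext.
- apply: linear_comp (tmap_linear lc lid) _.
  exact: linear_comp (@tassoc_linear _ _ _ _) ((tpure_bilin _ _).2 u).
- by move=> a x y; rewrite scalerDr !scalerA mulrC.
move=> v w; rewrite tassoc_pure tmap_pure// contract_pure//.
by rewrite (linearmZ ((tpure_bilin _ _).1 w)).
Qed.

(** The coefficients are recovered by applying to the right factor the linear
    forms dual to [y]. *)
Lemma tens_coef_eq (U V : lmodType F) n (x x' : 'I_n -> U) (y : 'I_n -> V) :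
  lin_indep y ->
  \sum_i tpure (x i) (y i) = \sum_i tpure (x' i) (y i) -> x =1 x'.
Proof.
move=> yI xx' i.
have [phi [lphi phiE]] := dual_family (fun k => (k == i)%:R) yI.
have b := bilin_flip (form_bilin U lphi).
have lb := tlift_linear b.
have E (z : 'I_n -> U) :
    tlift (fun u v => phi v *: u) (\sum_i tpure (z i) (y i)) = z i.
  rewrite (linearm_sum lb) (bigD1 i)//= big1 => [|k /negbTE ki].
    by rewrite (tlift_pure _ _ b) phiE eqxx scale1r addr0.
  by rewrite (tlift_pure _ _ b) phiE ki scale0r.
by rewrite -(E x) xx' E.
Qed.

End Families.

(** * Finite-dimensional left coideals and their duals *)

Section Coideals.
Variables (F : fieldType) (B : algGroup F).
Notation A := (Defs.coord B).

(** The span of the [y p] is a left coideal. *)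
Definition coideal n (y : 'I_n -> A) : Prop :=
  forall p, tens_span y (comul (y p)).

(** If [comul a] is the sum of the [x_i (x) y_i] with the [x_i] independent,
    the [y_i] span a left coideal: apply to coassociativity the linear form
    dual to [x_p] on the first factor to isolate [comul y_p].  The counit
    axiom puts [a] in this span. *)
Lemma coideal_ex (a : A) : exists n (y : 'I_n -> A), coideal y /\ lin_span y a.
Proof.
have [n [x [y [xI aE]]]] := tens_indep (comul a).
have lid (V : lmodType F) := @linear_idm F V.
have lD := @comul_linear _ B.
exists n, y; split=> [p|]; last first.
  exists (fun i => counit (x i)).
  have b := bilin_flip (counit_bilin B A).
  rewrite -[LHS](comul_counitl a) aE (linearm_sum (tlift_linear b)).
  by apply: eq_bigr => i _; rewrite (tlift_pure _ _ b).
have [phi [lphi phiE]] := dual_family (fun k => (k == p)%:R) xI.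
have lc := @contract_linear _ _ A _ lphi.
exists (fun i => contract phi (comul (x i))).
have := congr1 (tmap (contract phi) id) (comulA a).
rewrite aE (linearm_sum (tmap_linear (lid _) lD)).
rewrite (linearm_sum (tmap_linear lD (lid _))).
rewrite (linearm_sum (@tassoc_linear _ _ _ _)).
rewrite !(linearm_sum (tmap_linear lc (lid _))).
rewrite (bigD1 p)//= big1 => [|k /negbTE kp]; rewrite tmap_pure// contract_tassoc//.
  rewrite phiE eqxx scale1r addr0 => ->.
  by apply: eq_bigr => i _; rewrite !tmap_pure.
by rewrite phiE kp scale0r.
Qed.

Lemma coideal_indep_ex N (z : 'I_N -> A) : exists n (y : 'I_n -> A),
  [/\ coideal y, lin_indep y & forall r, lin_span y (z r)].
Proof.
have /choice[g gP] : forall r, exists g : {n & 'I_n -> A},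
    coideal (tagged g) /\ lin_span (tagged g) (z r).
  by move=> r; have [n [y yP]] := coideal_ex (z r); exists (Tagged _ y).
have [M [f [fg gf]]] := family_union (fun r => tagged (g r)).
have [n [s [yI fy]]] := lin_indep_subfamily f.
have gy r k : lin_span (fun l => f (s l)) (tagged (g r) k).
  by have [q <-] := fg r k.
exists n, (fun l => f (s l)); split=> // [p|r].
  have [r [k ->]] := gf (s p); have [/(_ k) gC _] := gP r.
  exact: tens_span_sub gC.
have [_ [c ->]] := gP r.
by apply: lin_closed_sum => //; exact: lin_span_closed.
Qed.

(** The dual of the left coideal spanned by [y], in the basis dual to [y].
    Comparing coefficients of [y] in the coassociativity and counit axioms
    shows that [b] is a multiplicative matrix: [comul (b p q)] is the sum of the
    [b p l (x) b l q], and [counit (b p q)] is 1 or 0 as [p = q] or not.  These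
    are the two axioms of a representation. *)
Lemma coideal_dual_rep n (y : 'I_n -> A) (b : 'I_n -> 'I_n -> A) :
  lin_indep y -> (forall p, comul (y p) = \sum_q tpure (b p q) (y q)) ->
  exists r : rep B 'rV[F]_n, forall u,
    coact r u = \sum_p tpure (delta_mx 0 p) (\sum_q u 0 q *: b p q).
Proof.
move=> yI yE.
have lid (V : lmodType F) := @linear_idm F V.
have lD := @comul_linear _ B.
have b_counit p q : counit (b p q) = (q == p)%:R.
  move: q; apply: (lin_indep_eq yI).
  have bc := bilin_flip (counit_bilin B A).
  rewrite [RHS](bigD1 p)//= eqxx scale1r [X in _ + X]big1 => [|k /negbTE->];
    last exact: scale0r.
  rewrite addr0 -[RHS](comul_counitl (y p)) yE (linearm_sum (tlift_linear bc)).
  by apply: eq_bigr => q _; rewrite (tlift_pure _ _ bc).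
have b_comul p q : comul (b p q) = \sum_l tpure (b p l) (b l q).
  move: q; apply: (tens_coef_eq yI).
  have := comulA (y p); rewrite yE (linearm_sum (tmap_linear (lid _) lD)).
  rewrite (linearm_sum (tmap_linear lD (lid _))).
  rewrite (linearm_sum (@tassoc_linear _ _ _ _)) => E.
  have <- : \sum_i tmap (@comul _ B) id (tpure (b p i) (y i)) =
      \sum_i tpure (comul (b p i)) (y i).
    by apply: eq_bigr => i _; rewrite tmap_pure.
  rewrite -E.
  under eq_bigr => l _.
    rewrite tmap_pure// yE (linearm_sum ((tpure_bilin _ _).2 _)).
    rewrite (linearm_sum (@tassoc_linear _ _ _ _)).
    under eq_bigr do rewrite tassoc_pure.
    over.
  rewrite exchange_big /=; apply: eq_bigr => q _.
  by rewrite (linearm_sum ((tpure_bilin _ _).1 _)).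
pose rho (u : 'rV[F]_n) : tens 'rV[F]_n A :=
  \sum_p tpure (delta_mx 0 p) (\sum_q u 0 q *: b p q).
have lrho : linear rho.
  move=> a u v; rewrite /rho scaler_sumr -big_split /=; apply: eq_bigr => p _.
  rewrite -(tpure_bilin _ _).2; congr tpure.
  rewrite scaler_sumr -big_split /=; apply: eq_bigr => q _.
  by rewrite !mxE scalerDl scalerA.
have rho_delta l : rho (delta_mx 0 l) = \sum_p tpure (delta_mx 0 p) (b p l).
  apply: eq_bigr => p _; congr tpure.
  rewrite (bigD1 l)//= mxE !eqxx scale1r big1 ?addr0// => k /negbTE kl.
  by rewrite mxE kl andbF scale0r.
have rhoA u : tassoc (tmap id (@comul F B) (rho u)) = tmap rho id (rho u).
  rewrite {1 3}/rho (linearm_sum (tmap_linear (lid _) lD)).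
  rewrite (linearm_sum (tmap_linear lrho (lid _))).
  rewrite (linearm_sum (@tassoc_linear _ _ _ _)).
  under [RHS]eq_bigr => l _.
    rewrite tmap_pure// rho_delta (linearm_sum ((tpure_bilin _ _).1 _)).
    over.
  rewrite [RHS]exchange_big /=; apply: eq_bigr => p _.
  rewrite tmap_pure//.
  have -> : comul (\sum_q u 0 q *: b p q) =
      \sum_l tpure (b p l) (\sum_q u 0 q *: b l q).
    rewrite (linearm_sum lD).
    under eq_bigr do rewrite (linearmZ lD) b_comul scaler_sumr.
    rewrite exchange_big /=; apply: eq_bigr => l _.
    by rewrite tpure_sumr.
  rewrite (linearm_sum ((tpure_bilin _ _).2 _)).
  rewrite (linearm_sum (@tassoc_linear _ _ _ _)).
  by apply: eq_bigr => l _; rewrite tassoc_pure.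
have rho_counit u : tlift (fun w a => counit a *: w) (rho u) = u.
  have bc := counit_bilin B 'rV[F]_n.
  rewrite (linearm_sum (tlift_linear bc)) [RHS]row_sum_delta.
  apply: eq_bigr => p _; rewrite (tlift_pure _ _ bc); congr (_ *: _).
  have lc : linear (@counit _ B : A -> F^o) := @counit_linear _ B.
  rewrite (linearm_sum lc) (bigD1 p)//= (linearmZ lc) b_counit eqxx.
  rewrite big1 => [|q /negbTE qp]; last by rewrite (linearmZ lc) b_counit qp scaler0.
  by rewrite addr0; exact: mulr1.
by exists (Rep lrho rhoA rho_counit).
Qed.

(** If [w p] is the image of the dual basis vector [p] under
    [g |-> (id (x) g)(coact v)], then the [w p] transform under [B] like the
    dual basis: compare coefficients of [y] in the coassociativity of [rho]. *)
Lemma coideal_coact (V : lmodType F) (rho : rep B V) (v : V) n (y : 'I_n -> A)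
    (b : 'I_n -> 'I_n -> A) (w : 'I_n -> V) :
  lin_indep y -> (forall p, comul (y p) = \sum_q tpure (b p q) (y q)) ->
  coact rho v = \sum_p tpure (w p) (y p) ->
  forall q, coact rho (w q) = \sum_p tpure (w p) (b p q).
Proof.
move=> yI yE vE; apply: (tens_coef_eq yI).
have lid (V' : lmodType F) := @linear_idm F V'.
have lD := @comul_linear _ B; have lrho := @coact_linear _ _ _ rho.
have := coactA rho v; rewrite vE (linearm_sum (tmap_linear (lid _) lD)).
rewrite (linearm_sum (tmap_linear lrho (lid _))).
rewrite (linearm_sum (@tassoc_linear _ _ _ _)).
under [in RHS]eq_bigr => p _ do rewrite tmap_pure//.
move=> <-.
under eq_bigr => p _.
  rewrite tmap_pure// yE (linearm_sum ((tpure_bilin _ _).2 _)).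
  rewrite (linearm_sum (@tassoc_linear _ _ _ _)).
  under eq_bigr do rewrite tassoc_pure.
  over.
rewrite exchange_big /=; apply: eq_bigr => q _.
by rewrite (linearm_sum ((tpure_bilin _ _).1 _)).
Qed.

Lemma coideal_counit (V : lmodType F) (rho : rep B V) (v : V) n
    (y : 'I_n -> A) (w : 'I_n -> V) :
  coact rho v = \sum_p tpure (w p) (y p) -> v = \sum_p counit (y p) *: w p.
Proof.
move=> vE; rewrite -[LHS](coact_counit rho) vE.
have bc := counit_bilin B V.
rewrite (linearm_sum (tlift_linear bc)); apply: eq_bigr => p _.
exact: tlift_pure bc.
Qed.

End Coideals.
(** * Covering a representation by representations defined over [F] *)

Section Covering.
Variables (F K : fieldType) (iota : {rmorphism F -> K}) (B : algGroup F).
Notation j := (@inext F K iota _).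
Notation A := (Defs.coord B).

Let sj (V : lmodType F) : semilin iota (@inext F K iota V).
Proof. exact: inext_semilin. Qed.

(** The coefficients of [t] in [K (x) A] involve finitely many elements of [A],
    so the coideal can be found over [F]. *)
Lemma tens_span_coideal (V : lmodType K) (t : tens V (ext iota A)) :
  exists n (y : 'I_n -> A),
    [/\ coideal y, lin_indep y & tens_span (fun p => j (y p)) t].
Proof.
have [n [x tx]] := tens_spanned t.
have [N [c [z [_ xE]]]] := ext_family x.
have [M [f [fz _]]] := family_union z.
have [m [y [yC yI fy]]] := coideal_indep_ex f.
exists m, y; split=> //; apply: tens_span_sub tx => i.
rewrite xE; apply: lin_closed_sum => [|s]; first exact: lin_span_closed.
have [q <-] := fz i s; have [a ->] := fy q.
by exists (fun p => iota (a p)); rewrite inext_sum.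
Qed.

(** [r] is the dual of a left coideal containing the coefficients of
    [coact rho v], and [L] sends the basis vector [p] to the coefficient [w p]
    of [y p]; the preimage of [v] is the counit, viewed as a linear form on the
    coideal. *)
Lemma rep_cover (V : lmodType K) (rho : rep (ext_group iota B) V) (v : V) :
  exists m (r : rep B 'rV[F]_m) (L : ext iota 'rV[F]_m -> V) u,
    hom_rep (ext_rep iota r) rho L /\ L u = v.
Proof.
have [m [y [/choice[b bE] yI [w vE]]]] := tens_span_coideal (coact rho v).
have [r rE] := coideal_dual_rep yI bE.
have lid (V' : lmodType K) := @linear_idm K V'.
have lrho := @coact_linear _ _ _ rho.
have jbE p : @comul _ (ext_group iota B) (j (y p)) =
    \sum_q tpure (j (b p q)) (j (y q)).
  rewrite /= ext_comul_in bE.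
  rewrite (@linearm_sum _ _ (restr iota _) _ (@text_semilin _ _ iota _ _)).
  by apply: eq_bigr => q _; exact: text_pure.
have wE := @coideal_coact K (ext_group iota B) V rho v m (fun p => j (y p))
  (fun p q => j (b p q)) w (inext_lin_indep (iota := iota) yI) jbE vE.
pose l (u : 'rV[F]_m) := \sum_p iota (u 0 p) *: w p.
have sl : semilin iota l.
  move=> a u u'; rewrite /l scaler_sumr -big_split /=; apply: eq_bigr => p _.
  by rewrite !mxE rmorphD rmorphM scalerDl scalerA.
have lL := elift_linear sl.
have l_delta p : l (delta_mx 0 p) = w p.
  rewrite /l (bigD1 p)//= mxE !eqxx rmorph1 scale1r big1 ?addr0// => q /negbTE qp.
  by rewrite mxE qp andbF rmorph0 scale0r.
exists m, r, (elift l), (j (\row_p counit (y p))); split; first split=> //.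
  apply: ext_ext => [||u].
  - exact: linear_comp lrho lL.
  - exact: linear_comp (tmap_linear lL (lid _))
      (@coact_linear _ _ _ (ext_rep iota r)).
  rewrite (elift_in _ sl) /= ext_coact_in rE.
  rewrite (@linearm_sum _ _ (restr iota _) _ (@text_semilin _ _ iota _ _)).
  rewrite (linearm_sum (tmap_linear lL (lid _))) (linearm_sum lrho).
  under eq_bigr do rewrite (linearmZ lrho) wE scaler_sumr.
  rewrite exchange_big /=; apply: eq_bigr => p _.
  by rewrite text_pure tmap_pure// (elift_in _ sl) l_delta inext_sum tpure_sumr.
rewrite (elift_in _ sl) (@coideal_counit K (ext_group iota B) V rho v m
  (fun p => j (y p)) w vE); apply: eq_bigr => p _.
by rewrite mxE /= ext_counit_in.
Qed.

(** A morphism [h] is determined by its values on a basis [b] of [V], and by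
    [rep_cover] the value at [b`_i] is that of a morphism [U_K -> X_K] at a
    fixed vector, with [U] depending only on [i]. *)
Lemma finite_dim_hom_ext (X : lmodType F) (rX : rep B X) :
  (forall (V : vectType F) (r : rep B V), finite_dim (hom_rep r rX)) ->
  forall (V : vectType K) (rho : rep (ext_group iota B) V),
    finite_dim (hom_rep rho (ext_rep iota rX)).
Proof.
move=> fin V rho; pose b := vbasis (fullv : {vspace V}).
have /choice[g gP] : forall i : 'I_(\dim (fullv : {vspace V})),
    exists g : {n & 'I_n -> ext iota X},
    forall h, hom_rep rho (ext_rep iota rX) h -> lin_span (tagged g) (h b`_i).
  move=> i; have [m [r [L [u [LS Lu]]]]] := rep_cover rho b`_i.
  have [N [e [eS span_e]]] := fin _ r.
  exists (Tagged (fun n => 'I_n -> ext iota X) (fun k => emap (e k) u)) => h hS.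
  have [c hE] := hom_rep_ext_span eS span_e (hom_rep_comp hS LS).
  by exists c; rewrite -Lu -[LHS]/((fun u => h (L u)) u) hE sum_fctE.
have [M [f [fg _]]] := family_union
  (fun i k (v : V) => coord b i v *: tagged (g i) k).
apply: (finite_dim_sub (g := f)) (hom_rep_closed _ _) _ => h hS.
(* The scalar 1 gives the sum the shape of a linear combination. *)
have -> : h = \sum_i 1 *: (fun v => coord b i v *: h b`_i).
  apply/funext => v; rewrite sum_fctE [in LHS](coord_vbasis (memvf v)).
  rewrite (linearm_sum hS.1); apply: eq_bigr => i _.
  by rewrite (linearmZ hS.1) scale1r.
apply: lin_closed_sum => [|i]; first exact: lin_span_closed.
have [c ->] := gP i h hS.
have -> : (fun v => coord b i v *: \sum_k c k *: tagged (g i) k) =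
    \sum_k c k *: (fun v => coord b i v *: tagged (g i) k).
  apply/funext => v; rewrite sum_fctE scaler_sumr; apply: eq_bigr => k _.
  by rewrite -[RHS]/(c k *: (_ *: _)) !scalerA mulrC.
apply: lin_closed_sum => [|k]; first exact: lin_span_closed.
by have [q <-] := fg i k; exact: lin_span_gen.
Qed.

End Covering.

Theorem proposition3p6 (F : fieldType) (charF : [pchar F] =i pred0)
    (P : pair_data F) (hP : is_pair P) (X : pair_module P) :
  (admissible X <->
     exists (F' : fieldType) (iota : {rmorphism F -> F'}),
       admissible (ext_module iota X)) /\
  (admissible X <->
     forall (F' : fieldType) (iota : {rmorphism F -> F'}),
       admissible (ext_module iota X)).
Proof.
have up (F' : fieldType) (iota : {rmorphism F -> F'}) :
    admissible X -> admissible (ext_module iota X).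
  by move=> fin V r; exact: finite_dim_hom_ext.
have down (F' : fieldType) (iota : {rmorphism F -> F'}) :
    admissible (ext_module iota X) -> admissible X.
  by move=> fin V r; exact: (finite_dim_hom_descent (fin _ (ext_rep iota r))).
split; split=> [h|].
- by exists F, idfun; exact: up.
- by move=> [F' [iota]]; exact: down.
- by move=> F' iota; exact: up.
- by move=> /(_ F idfun); exact: down.
Qed.
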